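(* Assume the following. (i) $\Theta\subset\mathbb{R}^s$ is convex and compact with nonempty interior. (ii) There are constants $c_1\ge c_2>0$ such that the prior density satisfies $c_1\ge p(\theta)\ge c_2$ for all $\theta\in\Theta$. (iii) For every $(\xi,\eta)\in\Xi\times\mathcal{H}$, $f(\xi|\eta,\theta)>0$ for all $\theta\in\Theta$. (iv) For every $(\xi,\eta)\in\Xi\times\mathcal{H}$, $\theta\mapsto f(\xi|\eta,\theta)$ is continuous on $\Theta$. (v) The Markov chain $\{\eta_t\}_{t\ge1}$ is irreducible and aperiodic. (vi) $\log f(\xi|\eta,\theta)$, $\theta\in\Theta$, is dominated by an integrable function with respect to $P^*$. Let $\theta_N$ be a random variable with the posterior density $\mathsf{p}_N$ (conditionally on the data). Then, $\mathbb{P}^*$-almost surely, $\mathrm{dist}(\theta_N,\Theta^* )$ converges to $0$ in probability with respect to the posterior measures $\mathsf{P}_N$ as $N\to\infty$; that is, $\mathbb{P}^*$-almost surely, for every $\varepsilon>0$, $\mathsf{P}_N(\{\theta\in\Theta:\mathrm{dist}(\theta,\Theta^* )>\varepsilon\})\to0$ as $N\to\infty$. In particular, if $\Theta^*=\{\theta^*\}$ is a singleton, then $\mathbb{P}^*$-almost surely $\theta_N$ converges to $\theta^*$ in $\mathsf{P}_N$-probability.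
   Context: $\mathcal{H}$ is a finite set and $\{\eta_t\}_{t\ge1}$ is a time-homogeneous Markov chain on $\mathcal{H}$ with transition probabilities $\varpi_{h,h'}=\mathbb{P}(\eta_{t+1}=h'|\eta_t=h)$ and deterministic $\eta_1$. $\Xi\subset\mathbb{R}^d$ is closed. Conditional on $\eta_t$, the random vector $\xi_t\in\Xi$ has density $q(\cdot|\eta_t)$ and is conditionally independent of the past; also $\eta_{t+1}$ conditional on $\eta_t$ is independent of $(\xi_1,\dots,\xi_t)$; and $\xi_i$ is conditionally independent of $\xi_1,\dots,\xi_{i-1}$ given $\{\eta_i\}_{i=1}^N$. $\mathbb{P}^*$ denotes the law of this true data-generating process $\{(\xi_t,\eta_t)\}_{t\ge1}$. $\{f(\cdot|\eta,\theta):\theta\in\Theta\}$, $\eta\in\mathcal{H}$, is a parametric family of probability densities on $\Xi$, with $\Theta\subset\mathbb{R}^s$, and $p$ is a prior density on $\Theta$. The model need not contain $q$. The posterior density given $(\xi_i,\eta_i)$, $i=1,\dots,N$, is $$\mathsf{p}_N(\theta)=\frac{\mathsf{f}_N(\theta)p(\theta)}{\int_\Theta \mathsf{f}_N(\vartheta)p(\vartheta)\,\mathrm{d}\vartheta},\qquad \mathsf{f}_N(\theta)=f(\xi_1|\eta_1,\theta)\prod_{i=2}^N\big[f(\xi_i|\eta_i,\theta)\varpi_{\eta_{i-1},\eta_i}\big],$$ and $\mathsf{P}_N(A)=\int_A\mathsf{p}_N(\theta)\,\mathrm{d}\theta$ for measurable $A\subset\Theta$. $\nu_\eta$ denotes the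 stationary distribution of the chain $\{\eta_t\}$, and $P^*$ is the stationary one-period law $\mathrm{d}P^*(\xi,\eta)=\nu_\eta(\eta)q(\xi|\eta)\,\mathrm{d}\xi$ on $\Xi\times\mathcal{H}$. Define $\lambda(\theta)=\mathbb{E}_{P^*}[\log f(\xi|\eta,\theta)]$ and $\Theta^*=\arg\max_{\theta\in\Theta}\lambda(\theta)$. For a set $A\subset\mathbb{R}^s$, $\mathrm{dist}(\theta,A)=\inf_{\theta'\in A}\|\theta-\theta'\|_2$. *)

(* Defs.v *)
From HB Require Import structures.
From mathcomp Require Import all_boot all_order all_algebra.
From mathcomp Require Import all_classical all_reals all_analysis.
From mathcomp Require Import measurable_realfun.

Set Implicit Arguments.
Unset Strict Implicit.
Unset Printing Implicit Defensive.
Import Order.TTheory GRing.Theory Num.Theory.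
Import numFieldNormedType.Exports.

Local Open Scope classical_set_scope.
Local Open Scope ring_scope.

(* Finite types whose sigma-algebra is discrete.  They are nonempty, because
   measurable types are pointed in the library. *)
HB.mixin Record isDiscreteMeasurable d T & Measurable d T := {
  measurable_discrete : forall A : set T, measurable A
}.

#[short(type="finMeasurableType")]
HB.structure Definition FinMeasurable d :=
  {T of Finite T & Measurable d T & isDiscreteMeasurable d T}.

(* The product sigma-algebra on row vectors, as the library does for tuples;
   for T := R it is the Borel sigma-algebra of R^n. *)
Definition measure_rV_display : measure_display -> measure_display.
Proof. exact. Qed.

Section measurable_rV.
Context {d} {T : sigmaRingType d}.
Variable n : nat.

Let coors : 'I_n -> 'rV[T]_n -> T := fun i x => x ord0 i.

Let rV_set0 : g_sigma_preimage coors set0.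
Proof. exact: sigma_algebra0. Qed.

Let rV_setC A : g_sigma_preimage coors A -> g_sigma_preimage coors (~` A).
Proof. exact: sigma_algebraC. Qed.

Let rV_bigcup (F : _^nat) : (forall i, g_sigma_preimage coors (F i)) ->
  g_sigma_preimage coors (\bigcup_i (F i)).
Proof. exact: sigma_algebra_bigcup. Qed.

HB.instance Definition _ := @isMeasurable.Build (measure_rV_display d)
  'rV[T]_n (g_sigma_preimage coors) rV_set0 rV_setC rV_bigcup.

End measurable_rV.

Lemma measurable_coord d (T : sigmaRingType d) n (i : 'I_n) :
  measurable_fun [set: 'rV[T]_n] (fun v : 'rV[T]_n => v ord0 i).
Proof.
move=> _ Y mY; rewrite setTI; apply: sub_sigma_algebra => /=.
rewrite -bigcup_seq/=; exists i => /=; first by rewrite mem_index_enum.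
by exists Y => //; rewrite setTI.
Qed.

Lemma measurable_fun_rVP d1 d2 (T1 : measurableType d1) (T2 : measurableType d2)
    n (f : T1 -> 'rV[T2]_n) :
  measurable_fun [set: T1] f <->
  forall i, measurable_fun [set: T1] (fun x => f x ord0 i).
Proof.
split=> [mf i|mf].
  exact: (measurableT_comp (measurable_coord i) mf).
apply: (@measurability _ _ _ _ setT f
  (\big[setU/set0]_(i < n)
     preimage_set_system setT (fun v : 'rV[T2]_n => v ord0 i) measurable)) => //.
rewrite -bigcup_seq => _ [_ [i _ [A mA <-]] <-].
by rewrite setTI; have := mf i measurableT A mA; rewrite !setTI.
Qed.

Section lebesgue_rV.
Variable R : realType.
Local Open Scope ereal_scope.

Definition cons_rV n (z : R * 'rV[R]_n) : 'rV[R]_n.+1 :=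
  row_mx (z.1%:M : 'rV[R]_1) z.2.

Lemma measurable_cons_rV n : measurable_fun setT (@cons_rV n).
Proof.
apply/measurable_fun_rVP => i.
rewrite /cons_rV; have [j ->|j ->] := split_ordP (i : 'I_(1 + n)).
  rewrite (_ : (fun _ => _) = fst); first exact: measurable_fst.
  apply/funext => z; rewrite (row_mxEl (z.1%:M : 'rV_1)) mxE.
  by rewrite (ord1 j) eqxx mulr1n.
rewrite (_ : (fun _ => _) = (fun v : 'rV[R]_n => v ord0 j) \o snd).
  exact: (measurableT_comp (measurable_coord j) measurable_snd).
by apply/funext => z; rewrite (row_mxEr (z.1%:M : 'rV_1)).
Qed.

(* n-dimensional Lebesgue measure, by slicing along the first coordinate. *)
Fixpoint lebesgue_rV n : set 'rV[R]_n -> \bar R :=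
  match n with
  | 0 => \d_(0%R : 'rV[R]_0)
  | m.+1 => fun A => \int[lebesgue_measure]_(t in [set: R])
                       lebesgue_rV [set v : 'rV[R]_m | A (cons_rV (t, v))]
  end.

Lemma lebesgue_rV_sigma_finite_measure n :
  {m : {sigma_finite_measure set 'rV[R]_n -> \bar R} | @lebesgue_rV n = m}.
Proof.
elim: n => [|n [m mE]]; first by exists (\d_(0%R : 'rV[R]_0)).
have mf : measurable_fun [set: measurableTypeR R * 'rV[R]_n] (@cons_rV n).
  exact: measurable_cons_rV.
pose p : {measure set 'rV[R]_n.+1 -> \bar R} :=
  measure_function_pushforward__canonical__measure_function_Measure
    (lebesgue_measure \x m) mf.
pose u (v : 'rV[R]_n.+1) : R * 'rV[R]_n :=
  ((v : 'rV[R]_(1 + n)) ord0 (lshift n ord0), rsubmx (v : 'rV[R]_(1 + n))).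
have mu : measurable_fun setT u.
  apply: measurable_fun_pair; first exact: measurable_coord.
  apply/measurable_fun_rVP => i.
  rewrite (_ : (fun _ => _) = fun v : 'rV[R]_(1 + n) => v ord0 (rshift 1 i)).
    exact: measurable_coord.
  by apply/funext => v; rewrite mxE.
have cK : cancel (@cons_rV n) u.
  move=> [t v]; rewrite /u/cons_rV/=; congr (_, _).
    by rewrite (row_mxEl (t%:M : 'rV_1)) mxE eqxx.
  exact: row_mxKr.
have sf : sigma_finite setT p.
  have [F FT Foo] : sigma_finite setT (lebesgue_measure \x m).
    have /sigma_finiteP[F [TF ndF Foo]] := sigma_finiteT (@lebesgue_measure R).
    have /sigma_finiteP[G [TG ndG Goo]] := sigma_finiteT m.
    exists (fun k => F k `*` G k).
      rewrite -setXTT TF TG predeqE => -[x y]; split.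
        move=> [/= [i _ Fix] [j _ Gjy]]; exists (maxn i j) => //; split.
        - by move: x Fix; exact/subsetPset/ndF/leq_maxl.
        - by move: y Gjy; exact/subsetPset/ndG/leq_maxr.
      by move=> [i _ []/= ? ?]; split; exists i.
    move=> k; have [? ?] := Foo k; have [? ?] := Goo k.
    split; first exact: measurableX.
    by rewrite product_measure1E// lte_mul_pinfty// ge0_fin_numE.
  exists (fun k => u @^-1` F k).
    by rewrite -preimage_bigcup -FT.
  move=> k; have [mF Fk] := Foo k; split.
    by rewrite -[X in measurable X]setTI; exact: mu.
  rewrite /p/= /pushforward/= -comp_preimage (_ : u \o _ = id)//.
  by apply/funext => z; exact: cK.
pose p' := HB.pack_for {sigma_finite_measure set 'rV[R]_n.+1 -> \bar R}
  (p : set _ -> \bar R) (Measure.class p) (Measure_isSigmaFinite.Build _ _ _ p sf).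
exists p'.
apply/funext => A /=; rewrite /pushforward/= /product_measure1 mE.
apply: eq_integral => t _ /=; congr (m _).
by apply/seteqP; split => v /=; rewrite /xsection/= inE.
Qed.

Section lebesgue_rV_measure.
Variable n : nat.

Let lebesgue_rV0 : @lebesgue_rV n set0 = 0.
Proof. by have [m ->] := lebesgue_rV_sigma_finite_measure n; rewrite measure0. Qed.

Let lebesgue_rV_ge0 A : 0 <= @lebesgue_rV n A.
Proof. by have [m ->] := lebesgue_rV_sigma_finite_measure n. Qed.

Let lebesgue_rV_sigma_additive : semi_sigma_additive (@lebesgue_rV n).
Proof.
have [m ->] := lebesgue_rV_sigma_finite_measure n.
exact: measure_semi_sigma_additive.
Qed.

HB.instance Definition _ := isMeasure.Build _ _ _ (@lebesgue_rV n)
  lebesgue_rV0 lebesgue_rV_ge0 lebesgue_rV_sigma_additive.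

Let lebesgue_rV_sigma_finite : sigma_finite setT (@lebesgue_rV n).
Proof.
by have [m ->] := lebesgue_rV_sigma_finite_measure n; exact: sigma_finiteT.
Qed.

HB.instance Definition _ := Measure_isSigmaFinite.Build _ _ _ (@lebesgue_rV n)
  lebesgue_rV_sigma_finite.

End lebesgue_rV_measure.

Lemma lebesgue_rV_box n (B : 'I_n -> set R) :
    (forall i, measurable (B i)) ->
  lebesgue_rV [set v : 'rV[R]_n | forall i, B i (v ord0 i)] =
  \prod_(i < n) lebesgue_measure (B i).
Proof.
elim: n B => [|n ih] B mB.
  have -> : [set v : 'rV[R]_0 | forall i, B i (v ord0 i)] = setT.
    by apply/seteqP; split=> // v _ [].
  by rewrite big_ord0 /= diracT.
have -> : [set v : 'rV[R]_n.+1 | forall i, B i (v ord0 i)] =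
    [set v : 'rV[R]_(1 + n) | B ord0 (v ord0 (lshift n (@ord0 0))) /\
      forall j, B (lift ord0 j) (v ord0 (rshift 1 j))].
  have E1 : (lshift n (@ord0 0) : 'I_n.+1) = ord0 by exact/val_inj.
  have E2 j : (rshift 1 j : 'I_n.+1) = lift ord0 j by exact/val_inj.
  apply/seteqP; split=> [v Bv|v [B0 Bj] i].
    by split=> [|j]; rewrite ?E1 ?E2; exact: Bv.
  have [j|] := unliftP ord0 i => ->; first by have := Bj j; rewrite E2.
  by move: B0; rewrite E1.
rewrite big_ord_recl /=.
set V := (X in _ = _ * X).
transitivity (\int[lebesgue_measure]_(t in [set: R]) ((\1_(B ord0) t)%:E * V)).
  apply: eq_integral => t _.
  have [Bt|Bt] := boolP (t \in B ord0).
    rewrite indicE Bt mul1e /V -ih; last by move=> i; exact: mB.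
    congr lebesgue_rV; apply/seteqP; split=> v /=.
      by move=> [_ Bv] j; have := Bv j; rewrite (row_mxEr (t%:M : 'rV_1)).
    move=> Bv; split=> [|j]; last by rewrite (row_mxEr (t%:M : 'rV_1)).
    by rewrite (row_mxEl (t%:M : 'rV_1)) mxE eqxx; exact: set_mem.
  rewrite indicE (negbTE Bt) mul0e.
  rewrite [X in lebesgue_rV X](_ : _ = set0) ?measure0//.
  apply/seteqP; split=> // v /=.
  rewrite (row_mxEl (t%:M : 'rV_1)) mxE eqxx => -[Bt' _].
  by move/negP: Bt; apply; exact: mem_set.
rewrite ge0_integralZr//=.
- by rewrite integral_indic ?setIT//; exact: mB.
- by apply/measurable_EFinP; apply: measurable_indic; exact: mB.
- by apply: prode_ge0.
Qed.

End lebesgue_rV.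

Section densities.
Variables (R : realType) (n : nat).

(* A probability density on D, extended by zero to the whole space. *)
Record is_density (D : set 'rV[R]_n) (g : 'rV[R]_n -> R) : Prop := {
  density_measurable : measurable_fun setT g;
  density_ge0 : forall x, 0 <= g x;
  density_off : forall x, ~ D x -> g x = 0;
  density_mass : (\int[@lebesgue_rV R n]_x (g x)%:E = 1)%E
}.

Record density (D : set 'rV[R]_n) := Density {
  density_fun :> 'rV[R]_n -> R;
  densityP : is_density D density_fun
}.

Definition enorm (v : 'rV[R]_n) : R := Num.sqrt (\sum_i v ord0 i ^+ 2).

(* Extended-real valued, so that the distance to the empty set is +oo. *)
Definition dist (x : 'rV[R]_n) (A : set 'rV[R]_n) : \bar R :=
  ereal_inf [set (enorm (x - y))%:E | y in A].

End densities.

Section markov_chain.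
Variables (R : realType) (dH : measure_display) (H : finMeasurableType dH).
Implicit Types w : H -> H -> R.

Definition stochastic w :=
  (forall h h', 0 <= w h h') /\ forall h, \sum_h' w h h' = 1.

Fixpoint nstep w n (h h' : H) : R :=
  if n is m.+1 then \sum_k w h k * nstep w m k h' else (h == h')%:R.

Definition irreducible w := forall h h', exists n, 0 < nstep w n h h'.

(* The gcd of the return times to every state is 1. *)
Definition aperiodic w := forall (h : H) (k : nat),
  (forall n, (0 < n)%N -> 0 < nstep w n h h -> (k %| n)%N) -> k = 1%N.

Definition stationary w (nu : probability H R) := forall h' : H,
  (nu [set h'] = \sum_(h : H) nu [set h] * (w h h')%:E)%E.

End markov_chain.

Section stationary_law.
Context {R : realType} {dH : measure_display} {H : finMeasurableType dH} {d : nat}.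
Variables (Xi : set 'rV[R]_d) (nu : probability H R) (q : H -> density Xi).
Local Open Scope ereal_scope.

Definition stationary_law (A : set ('rV[R]_d * H)) : \bar R :=
  \int[@lebesgue_rV R d \x nu]_(z in A) (q z.2 z.1)%:E.

Let mq : measurable_fun [set: 'rV[R]_d * H] (fun z => (q z.2 z.1)%:E).
Proof.
apply/measurable_EFinP => _ Y mY; rewrite setTI.
rewrite (_ : _ @^-1` _ = \big[setU/set0]_(h : H) ((q h @^-1` Y) `*` [set h])).
  apply: bigsetU_measurable => h _; apply: measurableX.
    by rewrite -[X in measurable X]setTI; exact: (density_measurable (densityP _)).
  exact: measurable_discrete.
rewrite -bigcup_seq; apply/seteqP; split=> [[x h] /= Yx|[x h] [k _ [/= Yx ->]]//].
by exists h => //=; rewrite mem_index_enum.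
Qed.

Let q_ge0 (z : 'rV[R]_d * H) : 0 <= (q z.2 z.1)%:E.
Proof. by rewrite lee_fin; exact: density_ge0 (densityP _) _. Qed.

Let stationary_law0 : stationary_law set0 = 0.
Proof. exact: integral_set0. Qed.

Let stationary_law_ge0 A : 0 <= stationary_law A.
Proof. by apply: integral_ge0 => z _; exact: q_ge0. Qed.

Let stationary_law_sigma_additive : semi_sigma_additive stationary_law.
Proof. exact: semi_sigma_additive_nng_induced mq q_ge0. Qed.

HB.instance Definition _ := isMeasure.Build _ _ _ stationary_law
  stationary_law0 stationary_law_ge0 stationary_law_sigma_additive.

Let stationary_lawT : stationary_law setT = 1.
Proof.
rewrite /stationary_law (fubini_tonelli2 _ mq q_ge0) /fubini_G.
under eq_integral => h _ do rewrite (density_mass (densityP (q h))).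
by rewrite integral_cst// mul1e; exact: probability_setT.
Qed.

HB.instance Definition _ := Measure_isProbability.Build _ _ _ stationary_law
  stationary_lawT.

End stationary_law.

Section data.
Context {R : realType} {dO dH : measure_display} {Omega : measurableType dO}.
Variable P : probability Omega R.
Context {H : finMeasurableType dH} {d : nat}.
Local Open Scope ereal_scope.

Definition sigma_rv d' (T : measurableType d') (X : Omega -> T) : set (set Omega) :=
  preimage_set_system setT X measurable.

(* F and G are conditionally independent given the finite-valued Z. *)
Definition cond_indep (T : finType) (Z : Omega -> T) (F G : set (set Omega)) :=
  forall (z : T) A B, F A -> G B -> let C := Z @^-1` [set z] in
    P (A `&` B `&` C) * P C = P (A `&` C) * P (B `&` C).

(* Time is counted from 0: (xi i, eta i) is the data pair at time i + 1. *)
Record data_process (w : H -> H -> R) (Xi : set 'rV[R]_d) (q : H -> density Xi)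
    (xi : {RV P >-> 'rV[R]_d}^nat) (eta : {RV P >-> H}^nat) : Prop := {
  data_stochastic : stochastic w;
  data_start : exists h, forall om, eta 0%N om = h;
  data_markov : forall t (h : nat -> H) h',
    P [set om | (forall i, (i <= t)%N -> eta i om = h i) /\ eta t.+1 om = h'] =
    P [set om | forall i, (i <= t)%N -> eta i om = h i] * (w (h t) h')%:E;
  data_support : forall t om, Xi (xi t om);
  data_density : forall t (h : H) A, measurable A ->
    P (xi t @^-1` A `&` eta t @^-1` [set h]) =
    P (eta t @^-1` [set h]) * \int[@lebesgue_rV R d]_(x in A) (q h x)%:E;
  data_past : forall t, cond_indep (eta t) (sigma_rv (xi t))
    (g_sigma_preimage (fun (i : 'I_t) om => (xi i om, eta i om)));
  data_next : forall t, cond_indep (eta t) (sigma_rv (eta t.+1))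
    (g_sigma_preimage (fun (i : 'I_t.+1) om => xi i om));
  data_path : forall N i, (i < N)%N ->
    cond_indep (fun om => [ffun j : 'I_N => eta j om]) (sigma_rv (xi i))
      (g_sigma_preimage (fun (j : 'I_i) om => xi j om))
}.

End data.

Section posterior.
Variables (R : realType) (dH : measure_display) (H : finMeasurableType dH).
Variables (d s : nat) (Theta : set 'rV[R]_s).
Variables (f : 'rV[R]_d -> H -> 'rV[R]_s -> R) (p : 'rV[R]_s -> R).
Variables (w : H -> H -> R) (x : nat -> 'rV[R]_d) (e : nat -> H).

(* Based on the first N data pairs, N >= 1. *)
Definition likelihood N (theta : 'rV[R]_s) : R :=
  f (x 0%N) (e 0%N) theta *
  \prod_(1 <= i < N) (f (x i) (e i) theta * w (e i.-1) (e i)).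

Definition posterior_density N (theta : 'rV[R]_s) : R :=
  likelihood N theta * p theta /
  \int[@lebesgue_rV R s]_(t in Theta) (likelihood N t * p t).

Definition posterior N (A : set 'rV[R]_s) : \bar R :=
  (\int[@lebesgue_rV R s]_(theta in A) (posterior_density N theta)%:E)%E.

End posterior.

Section optimal.
Variables (R : realType) (dH : measure_display) (H : finMeasurableType dH).
Variables (d s : nat) (Xi : set 'rV[R]_d) (Theta : set 'rV[R]_s).
Variables (nu : probability H R) (q : H -> density Xi).
Variable f : 'rV[R]_d -> H -> 'rV[R]_s -> R.

Definition expected_loglik (theta : 'rV[R]_s) : \bar R :=
  'E_(stationary_law nu q)[fun z => ln (f z.1 z.2 theta)].

Definition Theta_star : set 'rV[R]_s :=
  [set theta | Theta theta /\
    forall t, Theta t -> (expected_loglik t <= expected_loglik theta)%E].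

End optimal.

(* Main.v *)
Require Import Defs.
From HB Require Import structures.
From mathcomp Require Import all_boot all_order all_algebra.
From mathcomp Require Import all_classical all_reals all_analysis.
From mathcomp Require Import measurable_realfun.
From mathcomp Require Import ring lra.

Import Order.TTheory GRing.Theory Num.Theory.
Import numFieldNormedType.Exports.

Local Open Scope classical_set_scope.
Local Open Scope ring_scope.

(** The posterior density after N observations is proportional to
    a_N * exp (N * l_N theta) * p theta, where l_N theta is the average of
    ln (f (xi_i) (eta_i) theta) over the data and a_N, the product of the
    transition probabilities along the path, does not involve theta.  So
    everything rests on the uniform convergence of l_N to its stationary mean
    lam theta.  Once l_N is close to lam on all of Theta, a set on which lam
    stays delta below its maximum carries a mass that is exponentially small in
    N compared with a small ball around a maximizer; compactness gives such a
    delta for the points at distance more than eps from the maximizers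
    ([max_gap]), and convexity together with an interior point gives a ball of
    positive volume inside Theta near a maximizer ([convex_interior_ball]).
    The estimate itself is [posterior_cvg0].

    The uniform convergence ([uniform_strong_law]) is reduced to a strong law
    of large numbers for single integrable functions: to those in the family
    attached to a dense sequence of parameters, and to the oscillations of the
    log-likelihood over pairs of parameters closer than 1 / (n + 1).  By
    Heine's theorem the oscillations tend to 0 pointwise, hence in mean by
    domination.

    The strong law for a function phi of the pair (xi_i, eta_i) is
    [data_strong_law].  Given the chain, the values phi (xi_i, eta_i) minus
    their conditional means are uncorrelated, so phi (xi_i, eta_i) is the sum of
    a term of an orthogonal sequence and of a function of eta_i.  For nonnegative
    phi, truncation at level i and the method of Etemadi (second moments along
    geometrically growing times, then interpolation using a lower bound on the
    increments) handle the first part: this is [orthogonal_strong_law].  The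
    second part is governed by the visit frequencies of the chain, which
    converge to the stationary law ([ae_frequency]): by
    [orthogonal_strong_law] again, applied to the innovations
    1_{eta_{i+1} = k} - w eta_i k, the vector of frequencies is asymptotically
    invariant, and the stationary law is a stable solution of the invariance
    equations because a suitable perturbation of 1 - w is invertible. *)

(** * Averages along blocks of times *)

Definition mean {R : realType} (a : nat -> R) (N : nat) : R :=
  (\sum_(i < N) a i) / N%:R.

Lemma mean_cesaro (R : realType) (a : nat -> R) (l : R) :
  a @ \oo --> l -> mean a @ \oo --> l.
Proof.
move=> al; rewrite -(cvg_shiftS (mean a)).
have := cesaro al; apply: cvg_trans; apply: near_eq_cvg; apply: nearW => n /=.
by rewrite /mean /arithmetic_mean/= seriesEord/= mulrC.
Qed.

Lemma meanD (R : realType) (a b : nat -> R) N :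
  mean (fun i => a i + b i) N = mean a N + mean b N.
Proof. by rewrite /mean big_split/= mulrDl. Qed.

(** Times growing at least geometrically, by a factor of about 1 + 1 / (r + 1);
    the integer recursion avoids the rounding of powers of a real number. *)
Fixpoint block (r n : nat) : nat :=
  if n is m.+1 then (block r m + block r m %/ r.+1 + 1)%N else 1%N.

Lemma block_gt0 r n : (0 < block r n)%N.
Proof. by case: n => //= n; rewrite addn1. Qed.

Lemma block_lt r n : (block r n < block r n.+1)%N.
Proof. by rewrite /= addn1 ltnS leq_addr. Qed.

Lemma block_geq r n : (n < block r n)%N.
Proof. by elim: n => // n ih; rewrite (leq_trans _ (block_lt r n)). Qed.

Lemma block_ratio_ge r n : (r.+2 * block r n <= r.+1 * block r n.+1)%N.
Proof.
rewrite /= -addnA mulnDr (mulSn r.+1) (addnC (block r n)) leq_add2l.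
by rewrite addn1 mulnC ltnW// ltn_ceil.
Qed.

Lemma block_ratio_le r n : (r.+1 * block r n.+1 <= r.+2 * block r n + r.+1)%N.
Proof.
rewrite /= -addnA mulnDr (mulSn r.+1) (addnC (block r n)) -addnA leq_add2l.
by rewrite mulnDr muln1 leq_add2r mulnC leq_trunc_div.
Qed.

Lemma block_cover r N n0 : (block r n0 <= N)%N ->
  exists n, [/\ (n0 <= n)%N, (block r n <= N)%N & (N < block r n.+1)%N].
Proof.
move=> h0; have ub n : (block r n <= N)%N -> (n <= N)%N.
  by move=> /(leq_trans (block_geq r n))/ltnW.
pose n := ex_maxn (ex_intro (fun n => block r n <= N)%N n0 h0) ub.
exists n; rewrite /n; case: ex_maxnP => m hm mmax; split=> //.
- exact: mmax.
- by rewrite ltnNge; apply/negP => /mmax; rewrite ltnn.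
Qed.

(** Since the reciprocals of the block times decrease geometrically, each is at
    most r + 2 times the gap to the next one, and the sum telescopes from the
    first block time that reaches x. *)
Lemma block_sum_inv (R : realType) r (x : R) M : 0 < x ->
  \sum_(n < M | x <= (block r n)%:R) (block r n)%:R^-1 <= r.+2%:R / x.
Proof.
move=> x0.
have kgt0 n : 0 < (block r n)%:R :> R by rewrite ltr0n block_gt0.
have H n : (block r n)%:R^-1 <= r.+2%:R * ((block r n)%:R^-1 - (block r n.+1)%:R^-1) :> R.
  have := block_ratio_ge r n; rewrite -(@ler_nat R) !natrM.
  set k := (block r n)%:R; set k' := (block r n.+1)%:R => h.
  have k0 : 0 < k by exact: kgt0.
  have k0' : 0 < k' by exact: (kgt0 n.+1).
  rewrite -subr_ge0 -(@pmulr_rge0 _ (k * k')) ?mulr_gt0//.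
  have -> : k * k' * (r.+2%:R * (k^-1 - k'^-1) - k^-1) = r.+1%:R * k' - r.+2%:R * k.
    by rewrite -[r.+2]addn1 natrD; field; rewrite !gt_eqF.
  by rewrite subr_ge0.
suff : \sum_(n < M | x <= (block r n)%:R) (block r n)%:R^-1 <=
    r.+2%:R * (x^-1 - Num.min x^-1 (block r M)%:R^-1).
  move=> h; apply: (le_trans h); rewrite ler_wpM2l// lerBlDr lerDl.
  by rewrite le_min !invr_ge0 !ltW.
elim: M => [|M ih].
  by rewrite big_ord0 mulr_ge0// subr_ge0 ge_min lexx.
rewrite big_mkcond big_ord_recr/= -big_mkcond/=.
case: ifPn => xk.
  apply: (le_trans (lerD ih (H M))).
  rewrite -mulrDr ler_wpM2l//.
  have e : (block r M)%:R^-1 <= x^-1 by rewrite lef_pV2// posrE.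
  rewrite (min_r e); set a := _^-1 - _; rewrite /a subrKA lerD2l lerN2.
  by rewrite ge_min lexx orbT.
move: xk; rewrite -ltNge => xk; rewrite addr0 (le_trans ih)// {ih}.
have e : x^-1 <= (block r M)%:R^-1 by rewrite lef_pV2// ?posrE// ltW.
by rewrite (min_l e) subrr mulr0 mulr_ge0// subr_ge0 ge_min lexx.
Qed.

(** A lower bound on the terms limits how fast the partial sums can decrease,
    so the sum at any time is squeezed between those at the two neighbouring
    block times, up to b times the block length; relative to the time this error
    is about b / (r + 1), which is small for large r. *)
Lemma mean_block_interpolation (R : realType) (a : nat -> R) (b : R) :
  (forall i, - b <= a i) ->
  (forall r, (fun n => mean a (block r n)) @ \oo --> (0 : R)) ->
  mean a @ \oo --> (0 : R).
Proof.
move=> ab cv; wlog b0 : b ab / 0 < b.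
  move=> /(_ (Num.max b 1)); apply; last by rewrite lt_max ltr01 orbT.
  by move=> i; rewrite (le_trans _ (ab i))// lerN2 le_max lexx.
apply/cvgrPdist_le => e e0.
have [r rb] : exists r : nat, 4 * b / e < r.+1%:R.
  have [r hr] : exists r : nat, 4 * b / e < r%:R.
    by exists (Num.trunc (4 * b / e)).+1; rewrite truncnS_gt.
  by exists r; rewrite (lt_trans hr)// ltr_nat.
have /cvgrPdist_le/(_ (e / 8)) := cv r.
have e8 : 0 < e / 8 by rewrite divr_gt0.
move=> /(_ e8)[n1 _ n1P].
have [n2 n2P] : exists n : nat, 4 * b / e + 1 < n%:R.
  by exists (Num.trunc (4 * b / e + 1)).+1; rewrite truncnS_gt.
pose n0 := maxn n1 n2.
exists (block r n0) => //= N /block_cover[n [n0n kN Nk]].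
have k0 : 0 < (block r n)%:R :> R by rewrite ltr0n block_gt0.
have k'0 : 0 < (block r n.+1)%:R :> R by rewrite ltr0n block_gt0.
have N0 : 0 < N%:R :> R by rewrite (lt_le_trans k0)// ler_nat.
have := n1P n (leq_trans (leq_maxl _ _) n0n).
have := n1P n.+1 (leq_trans (leq_maxl _ _) (leqW n0n)).
rewrite !sub0r !normrN /mean.
have sumle p q : (p <= q)%N -> \sum_(i < p) a i - b * (q - p)%:R <= \sum_(i < q) a i.
  move=> pq; rewrite -!(big_mkord xpredT) (big_cat_nat _ pq)//= lerD2l.
  rewrite (le_trans _ (ler_sum _ (fun i _ => ab i)))//.
  by rewrite sumr_const_nat mulNrn mulr_natr.
have := sumle _ _ kN; have := sumle _ _ (ltnW Nk).
have dk : (block r n.+1 - block r n)%:R <= (block r n)%:R / r.+1%:R + 1 :> R.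
  rewrite natrB; last exact/ltnW/block_lt.
  have := block_ratio_le r n; rewrite -(@ler_nat R) natrD !natrM.
  move=> h; rewrite -(@ler_pM2l _ r.+1%:R)// mulrBr mulrDr mulrCA divff ?pnatr_eq0//.
  by rewrite mulr1 lerBlDr -[r.+2]addn1 natrD in h *; lra.
set S := \sum_(i < N) _; set S1 := \sum_(i < _) _; set S2 := \sum_(i < block r n) _.
have l1 : (N - block r n)%:R <= (block r n.+1 - block r n)%:R :> R.
  by rewrite ler_nat leq_sub2r// ltnW.
have l2 : (block r n.+1 - N)%:R <= (block r n.+1 - block r n)%:R :> R.
  by rewrite ler_nat leq_sub2l// ltnW.
have bn : b / r.+1%:R <= e / 4.
  rewrite ler_pdivrMr//; move: rb; rewrite ltr_pdivrMr//; lra.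
(* The block times are at least their indices. *)
have n2k : n2%:R <= (block r n)%:R :> R.
  rewrite ler_nat (leq_trans _ (ltnW (block_geq r n)))// (leq_trans _ n0n)//.
  exact: leq_maxr.
have bk : b <= e / 4 * (block r n)%:R.
  have : 4 * b / e <= (block r n)%:R by lra.
  rewrite ler_pdivrMr//; lra.
have k1 : 1 <= (block r n)%:R :> R by rewrite ler1n block_gt0.
have bd : b * (block r n.+1 - block r n)%:R <= e / 2 * (block r n)%:R.
  have : b * (block r n.+1 - block r n)%:R <= b * ((block r n)%:R / r.+1%:R + 1).
    by rewrite ler_wpM2l// ltW.
  move/le_trans; apply; rewrite mulrDr mulrCA mulr1.
  have : (block r n)%:R * (b / r.+1%:R) <= (block r n)%:R * (e / 4).
    by rewrite ler_wpM2l// ltW.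
  by move: bk; set u := _ * (_ / r.+1%:R); set k := _%:R; move=> *; lra.
have k3 : (block r n.+1)%:R <= 3 * (block r n)%:R :> R.
  have : (block r n)%:R / r.+1%:R <= (block r n)%:R :> R.
    by rewrite ler_pdivrMr// ler_peMr// ?ler1n// ltW.
  rewrite natrB in dk; last exact/ltnW/block_lt.
  by move: dk k1; set u := _ / r.+1%:R; set k := (block r n)%:R;
    set k2 := (block r n.+1)%:R; move=> *; lra.
have kNr : (block r n)%:R <= N%:R :> R by rewrite ler_nat.
have bl1 := ler_wpM2l (ltW b0) l1; have bl2 := ler_wpM2l (ltW b0) l2.
rewrite !normrM !normfV !(@ger0_norm _ _%:R) ?ler0n//.
rewrite !ler_pdivrMr// !ler_norml => h1 h2 /andP[h3 h4] /andP[h5 h6].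
have := ler_wpM2l (ltW e0) k3; have := ler_wpM2l (ltW e0) kNr.
move=> h7 h8; apply/andP; split; lra.
Qed.

(** * A strong law for orthogonal increments *)

Lemma EFin_integrableD {d} {T : measurableType d} {R : realType}
    (mu : {measure set T -> \bar R}) (D : set T) (f g : T -> R) :
  measurable D -> mu.-integrable D (EFin \o f) -> mu.-integrable D (EFin \o g) ->
  mu.-integrable D (EFin \o (fun x => f x + g x)).
Proof.
move=> mD fi gi; rewrite (_ : _ \o _ = (EFin \o f) \+ (EFin \o g))%E.
  exact: integrableD.
by apply/funext => x; rewrite /= EFinD.
Qed.

Lemma EFin_integrableB {d} {T : measurableType d} {R : realType}
    (mu : {measure set T -> \bar R}) (D : set T) (f g : T -> R) :
  measurable D -> mu.-integrable D (EFin \o f) -> mu.-integrable D (EFin \o g) ->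
  mu.-integrable D (EFin \o (fun x => f x - g x)).
Proof.
move=> mD fi gi; rewrite (_ : _ \o _ = (EFin \o f) \- (EFin \o g))%E.
  exact: integrableB.
by apply/funext => x; rewrite /= EFinB.
Qed.

Lemma bounded_integrable {d} {T : measurableType d} {R : realType}
    (mu : {finite_measure set T -> \bar R}) (g : T -> R) (M : R) :
  measurable_fun setT g -> (forall x, `|g x| <= M) ->
  mu.-integrable setT (EFin \o g).
Proof.
move=> mg gM; apply: measurable_bounded_integrable => //.
  by rewrite ltey_eq fin_num_measure.
exists M; split; first exact: num_real.
by move=> y My x _ /=; rewrite (le_trans (gM x))// ltW.
Qed.

Lemma nneseries_le_bound (R : realType) (u : nat -> \bar R) (C : \bar R) :
  (forall n, 0 <= u n)%E -> (forall M, \sum_(n < M) u n <= C)%E ->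
  (\sum_(n <oo) u n <= C)%E.
Proof.
move=> u0 uC; apply: lime_le; first exact: is_cvg_nneseries.
by apply: nearW => M; rewrite big_mkord.
Qed.

(** The pointwise sum of the series has a finite integral, so it is finite
    almost everywhere and its terms tend to 0. *)
Lemma ae_cvg0_of_summable_integrals {d} {T : measurableType d} {R : realType}
    (mu : {measure set T -> \bar R}) (u : nat -> T -> R) :
  (forall n, measurable_fun setT (u n)) -> (forall n x, 0 <= u n x) ->
  (\sum_(n <oo) \int[mu]_x (u n x)%:E < +oo)%E ->
  {ae mu, forall x, u ^~ x @ \oo --> (0 : R)}.
Proof.
move=> mu_ u0 sumoo.
have mEu n : measurable_fun setT (EFin \o u n) by exact/measurable_EFinP.
rewrite -integral_nneseries// in sumoo; last by move=> *; rewrite lee_fin.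
have := @integrable_ae _ T R mu setT measurableT (fun x => \sum_(n <oo) (u n x)%:E)%E.
have int : mu.-integrable setT (fun x => \sum_(n <oo) (u n x)%:E)%E.
  apply/integrableP; split.
    by apply: ge0_emeasurable_sum => [k x _ _|k _]; [rewrite lee_fin|exact: mEu].
  rewrite (le_lt_trans _ sumoo)// le_eqVlt; apply/orP; left; apply/eqP.
  apply: eq_integral => x _; rewrite gee0_abs//.
  by apply: nneseries_ge0 => *; rewrite lee_fin.
move=> /(_ int); apply: filterS => x /(_ I) xfin.
apply: cvg_series_cvg_0; apply: nondecreasing_is_cvgn.
  by apply/nondecreasing_seqP => n; rewrite seriesSr lerDl.
exists (fine (\sum_(n <oo) (u n x)%:E)%E) => _ [n _ <-].
rewrite -lee_fin fineK// seriesEnat/= -sumEFin.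
by apply: (@nneseries_lim_ge _ _ xpredT 0%N n) => *; rewrite lee_fin.
Qed.

Lemma sume_le_cst (R : realType) k (u : 'I_k -> \bar R) (c : \bar R) :
  (forall i, u i <= c)%E -> (\sum_(i < k) u i <= k%:R%:E * c)%E.
Proof.
elim: k u => [|k ih] u uc; first by rewrite big_ord0 mul0e.
rewrite big_ord_recr/= -natr1 EFinD ge0_muleDl ?lee_fin// mul1e.
by apply: leeD => //; apply: ih.
Qed.

Section orthogonal_increments.
Context {d} {T : measurableType d} {R : realType}.
Variable P : probability T R.
Variable X : nat -> T -> R.
Hypothesis mX : forall i, measurable_fun setT (X i).
Hypothesis bX : forall i, exists M, forall om, `|X i om| <= M.
Hypothesis orthX : forall i j, (i < j)%N -> \int[P]_om (X i om * X j om) = 0.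

Let partial k om := \sum_(i < k) X i om.

Let m_partial k : measurable_fun setT (partial k).
Proof. by apply: measurable_sum. Qed.

Let b_partial k : exists M, forall om, `|partial k om| <= M.
Proof.
elim: k => [|k [M hM]].
  by exists 0 => om; rewrite /partial big_ord0 normr0.
have [M' hM'] := bX k.
exists (M + M') => om; rewrite /partial big_ord_recr/=.
by rewrite (le_trans (ler_normD _ _))// lerD// hM.
Qed.

Let prod_integrable (f g : T -> R) :
  measurable_fun setT f -> measurable_fun setT g ->
  (exists M, forall om, `|f om| <= M) -> (exists M, forall om, `|g om| <= M) ->
  P.-integrable setT (EFin \o (fun om => f om * g om)).
Proof.
move=> mf mg [M fM] [M' gM'].
apply: (bounded_integrable P _ (M * M')); first exact: measurable_funM.
by move=> x; rewrite normrM ler_pM.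
Qed.

Lemma orthogonal_partial j k : (k <= j)%N ->
  \int[P]_om (partial k om * X j om) = 0.
Proof.
elim: k => [_|k ih kj].
  under eq_Rintegral do rewrite /partial big_ord0 mul0r.
  by rewrite Rintegral_cst// mul0r.
under eq_Rintegral do rewrite /partial big_ord_recr/= mulrDl.
have i1 := prod_integrable _ _ (m_partial k) (mX j) (b_partial k) (bX j).
have i2 := prod_integrable _ _ (mX k) (mX j) (bX k) (bX j).
rewrite (RintegralD measurableT i1 i2) [X in X + _](ih (ltnW kj)).
by rewrite orthX// add0r.
Qed.

Lemma orthogonal_sum_sqr k :
  \int[P]_om (\sum_(i < k) X i om) ^+ 2 = \sum_(i < k) \int[P]_om (X i om ^+ 2).
Proof.
elim: k => [|k ih].
  under eq_Rintegral do rewrite big_ord0 expr0n/=.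
  by rewrite Rintegral_cst// mul0r big_ord0.
under eq_Rintegral do rewrite big_ord_recr/= sqrrD -addrA mulr2n.
have i1 : P.-integrable setT (EFin \o (fun om => partial k om ^+ 2)).
  exact: prod_integrable.
have i2 : P.-integrable setT (EFin \o (fun om => partial k om * X k om)).
  exact: prod_integrable.
have i3 : P.-integrable setT (EFin \o (fun om => X k om ^+ 2)).
  exact: prod_integrable.
have i4 : P.-integrable setT
    (EFin \o (fun om => partial k om * X k om + partial k om * X k om)).
  exact: EFin_integrableD.
have i5 : P.-integrable setT
    (EFin \o (fun om => partial k om * X k om + partial k om * X k om + X k om ^+ 2)).
  exact: EFin_integrableD.
rewrite (RintegralD measurableT i1 i5) (RintegralD measurableT i4 i3).
rewrite (RintegralD measurableT i2 i2) orthogonal_partial// !add0r.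
by rewrite big_ord_recr/= -ih.
Qed.

(** By orthogonality the average at time k has second moment at most V k / k.
    Along a block sequence these moments are summable, which gives almost sure
    convergence there; the lower bound on the increments extends it to all
    times. *)
Lemma orthogonal_strong_law (b : R) (V : nat -> \bar R) :
  (forall i om, - b <= X i om) ->
  (forall i, (\int[P]_om (X i om ^+ 2)%:E <= V i)%E) ->
  {homo V : m n / (m <= n)%N >-> (m <= n)%E} ->
  (forall r, \sum_(n <oo) ((block r n)%:R^-1)%:E * V (block r n) < +oo)%E ->
  {ae P, forall om, mean (X ^~ om) @ \oo --> (0 : R)}.
Proof.
move=> Xb XV Vmono Vsum.
suff H r : {ae P, forall om, (fun n => (mean (X ^~ om) (block r n)) ^+ 2) @ \oo --> (0 : R)}.
  have : {ae P, forall om, forall r,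
      (fun n => (mean (X ^~ om) (block r n)) ^+ 2) @ \oo --> (0 : R)}.
    exact/ae_foralln.
  apply: filterS => om Hom; apply: (mean_block_interpolation _ _ b) => // r.
  apply/norm_cvg0P; under eq_fun do rewrite -sqrtr_sqr.
  have := cvg_comp _ _ (Hom r) (@sqrt_continuous R 0).
  by rewrite sqrtr0.
have sqr_int k : (\int[P]_om ((mean (X ^~ om) k) ^+ 2)%:E <= (k%:R^-1)%:E * V k)%E.
  have i1 : P.-integrable setT (EFin \o (fun om => partial k om ^+ 2)).
    exact: prod_integrable.
  have i2 i : P.-integrable setT (EFin \o (fun om => X i om ^+ 2)).
    exact: prod_integrable.
  under eq_integral do rewrite /mean exprMn mulrC EFinM.
  rewrite integralZl//= -[X in (_ * X)%E]fineK; last exact: integrable_fin_num.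
  rewrite -[fine _]/(\int[P]_om (partial k om ^+ 2)) orthogonal_sum_sqr.
  rewrite -sumEFin.
  have : (\sum_(i < k) (\int[P]_om X i om ^+ 2)%:E <= k%:R%:E * V k)%E.
    apply: sume_le_cst => i; rewrite fineK; last exact: (integrable_fin_num measurableT (i2 i)).
    by rewrite (le_trans (XV i))// Vmono// ltnW.
  case: k {i1} => [|k].
    by rewrite big_ord0 mule0 !invr0 !mul0e.
  move=> h; have c0 : (0 <= (k.+1%:R^-1 ^+ 2 : R)%:E)%E by rewrite lee_fin sqr_ge0.
  apply: (le_trans (lee_wpmul2l c0 h)).
  by rewrite muleA -EFinM expr2 -mulrA mulVf ?pnatr_eq0// mulr1.
apply: ae_cvg0_of_summable_integrals.
- move=> n; apply: measurable_funX; apply: measurable_funM => //.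
  exact: m_partial.
- by move=> n om; exact: sqr_ge0.
- apply: le_lt_trans (Vsum r); apply: lee_nneseries => n _.
    by move=> _; apply: integral_ge0 => om _; rewrite lee_fin sqr_ge0.
  exact: sqr_int.
Qed.

End orthogonal_increments.

(** * Finite stochastic matrices *)

Section finite_state_chain.
Context {R : realType} {dH : measure_display} {H : finMeasurableType dH}.
Variable w : H -> H -> R.
Hypothesis wS : stochastic w.
Hypothesis wI : irreducible w.

Lemma stochastic_le1 h k : w h k <= 1.
Proof.
have [w0 w1] := wS; rewrite -(w1 h) (bigD1 k)//= lerDl.
by apply: sumr_ge0.
Qed.

Lemma nstep_ge0 n h k : 0 <= nstep w n h k.
Proof.
have [w0 _] := wS; elim: n h => [|n ih] h /=; first exact: ler0n.
by apply: sumr_ge0 => l _; rewrite mulr_ge0.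
Qed.

Lemma nstep_sum n h : \sum_k nstep w n h k = 1.
Proof.
have [_ w1] := wS; elim: n h => [|n ih] h /=.
  rewrite (bigD1 h)//= eqxx big1 ?addr0// => k /negbTE.
  by rewrite eq_sym => ->.
by rewrite exchange_big/= -[RHS](w1 h); apply: eq_bigr => l _; rewrite -mulr_sumr ih mulr1.
Qed.

(** Maximum principle: at a point where u is maximal, u is an average of its
    values at all points that can be reached, so it takes its maximum at each of
    them. *)
Lemma harmonic_const (u : H -> R) :
  (forall h, u h = \sum_k w h k * u k) -> forall h k, u h = u k.
Proof.
move=> uh; have un n h : u h = \sum_k nstep w n h k * u k.
  elim: n h => [|n ih] h /=.
    rewrite (bigD1 h)//= eqxx mul1r big1 ?addr0// => k /negbTE.
    by rewrite eq_sym => ->; rewrite mul0r.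
  transitivity (\sum_l \sum_k w h l * (nstep w n l k * u k)).
    by rewrite uh; apply: eq_bigr => l _; rewrite ih mulr_sumr.
  rewrite exchange_big/=; apply: eq_bigr => k _; rewrite mulr_suml.
  by apply: eq_bigr => l _; rewrite mulrA.
suff M : forall h k, (forall l, u l <= u h) -> u k = u h.
  move=> h k; have [m _ mP] := @arg_maxP _ _ _ h xpredT u isT.
  by rewrite (M m h) ?(M m k)// => l; exact: mP.
move=> h k uM; have [n nP] := wI h k.
have : \sum_l nstep w n h l * (u h - u l) = 0.
  under eq_bigr do rewrite mulrBr.
  by rewrite sumrB -un -mulr_suml nstep_sum mul1r subrr.
move=> /eqP; rewrite psumr_eq0; last first.
  by move=> l _; rewrite mulr_ge0 ?nstep_ge0// subr_ge0.
move=> /allP/(_ k); rewrite mem_index_enum => /(_ isT)/=.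
by rewrite mulf_eq0 gt_eqF//= subr_eq0 => /eqP.
Qed.

Variable nu : H -> R.
Hypothesis nu0 : forall h, 0 <= nu h.
Hypothesis nu1 : \sum_h nu h = 1.
Hypothesis nuS : forall k, nu k = \sum_h nu h * w h k.

Lemma stationary_gt0 k : 0 < nu k.
Proof.
have nun n l : nu l = \sum_h nu h * nstep w n h l.
  elim: n => [|n ih] /=.
    rewrite (bigD1 l)//= eqxx mulr1 big1 ?addr0// => h /negbTE ->.
    by rewrite mulr0.
  transitivity (\sum_m \sum_h nu h * w h m * nstep w n m l).
    by rewrite ih; apply: eq_bigr => m _; rewrite nuS mulr_suml.
  rewrite exchange_big/=; apply: eq_bigr => h _; rewrite mulr_sumr.
  by apply: eq_bigr => m _; rewrite mulrA.
have [h hP] : exists h, 0 < nu h.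
  apply/not_existsP => no; have : (\sum_h nu h <= 0).
    by apply: sumr_le0 => h _; rewrite leNgt; apply/negP; exact: no.
  by rewrite nu1 ler10.
have [n nP] := wI h k; rewrite (nun n k) (bigD1 h)//= ltr_pwDl ?mulr_gt0//.
by apply: sumr_ge0 => l _; rewrite mulr_ge0 ?nstep_ge0.
Qed.

(** The matrix 1 - w + 1 nu: adding the rank one term 1 nu makes 1 - w
    invertible without affecting row vectors of total mass 0. *)
Let A : 'M[R]_#|H| := \matrix_(i, j)
  ((i == j)%:R - w (enum_val i) (enum_val j) + nu (enum_val j)).

Let sum_enum (F : H -> R) : \sum_(i < #|H|) F (enum_val i) = \sum_h F h.
Proof. by rewrite [RHS](reindex _ (onW_bij _ (enum_val_bij H))). Qed.

(** If A u = 0, applying nu gives nu u = 0, so u is harmonic, hence constant,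
    and the constant is nu u = 0. *)
Let A_unit : A \in unitmx.
Proof.
rewrite unitmxE unitfE -det_tr; apply/det0P => -[v /negP v0 vA]; apply: v0.
pose u h := v ord0 (enum_rank h).
have uA h : u h - \sum_k w h k * u k + \sum_k nu k * u k = 0.
  have := congr1 (fun M : 'rV_#|H| => M ord0 (enum_rank h)) vA.
  rewrite !mxE; apply: etrans.
  under [RHS]eq_bigr do rewrite !mxE mulrC mulrDl mulrBl.
  rewrite big_split sumrB/=; congr (_ - _ + _).
  - rewrite (bigD1 (enum_rank h))//= eqxx mul1r big1 ?addr0// => i /negbTE.
    by rewrite eq_sym => ->; rewrite mul0r.
  - rewrite -(sum_enum (fun k => w h k * u k)); apply: eq_bigr => i _.
    by rewrite enum_rankK /u enum_valK.
  - rewrite -(sum_enum (fun k => nu k * u k)); apply: eq_bigr => i _.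
    by rewrite /u enum_valK.
have nuu : \sum_k nu k * u k = 0.
  have : \sum_h nu h * (u h - \sum_k w h k * u k + \sum_k nu k * u k) = 0.
    by apply: big1 => h _; rewrite uA mulr0.
  under eq_bigr do rewrite mulrDr mulrBr.
  rewrite big_split sumrB/= -mulr_suml nu1 mul1r.
  rewrite [X in _ - X + _](_ : _ = \sum_k nu k * u k) ?subrr ?add0r//.
  under eq_bigr do rewrite mulr_sumr.
  rewrite exchange_big/=; apply: eq_bigr => k _.
  by rewrite [in RHS]nuS mulr_suml; apply: eq_bigr => h _; rewrite mulrA.
have uc : forall h k, u h = u k.
  apply: harmonic_const => h; apply/eqP; rewrite -subr_eq0.
  by have := uA h; rewrite nuu addr0 => ->.
apply/eqP/rowP => i; rewrite mxE -(enum_valK i) -/(u _).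
rewrite -[LHS]mul1r -nu1 mulr_suml -[RHS]nuu; apply: eq_bigr => k _.
by rewrite (uc _ k).
Qed.

(** The image of L N - nu under the invertible matrix 1 - w + 1 nu tends to 0,
    hence so does L N - nu. *)
Lemma stationary_attracts (L : nat -> H -> R) :
  (\sum_h L N h) @[N --> \oo] --> (1 : R) ->
  (forall k, (L N k - \sum_h L N h * w h k) @[N --> \oo] --> (0 : R)) ->
  forall k, L ^~ k @ \oo --> nu k.
Proof.
move=> L1 LW k.
pose y N k := (L N k - \sum_h L N h * w h k) + (\sum_h L N h - 1) * nu k.
have y0 l : y ^~ l @ \oo --> (0 : R).
  have L0 := cvgB L1 (cvg_cst (1 : R)); rewrite subrr in L0.
  have L0' : (\sum_h L N h - 1) @[N --> \oo] --> (0 : R) by exact: L0.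
  have := cvgD (LW l) (cvgMr_tmp (b := nu l) L0').
  by rewrite mul0r addr0; apply.
have LE N : L N k = nu k + \sum_(i < #|H|) y N (enum_val i) * invmx A i (enum_rank k).
  pose x : 'rV[R]_#|H| := \row_i (L N (enum_val i) - nu (enum_val i)).
  have xA : x *m A = \row_i y N (enum_val i).
    apply/rowP => j; rewrite !mxE.
    under eq_bigr do rewrite !mxE mulrDr mulrBr.
    rewrite big_split sumrB/= -mulr_suml.
    rewrite (sum_enum (fun h => (L N h - nu h) * w h (enum_val j))).
    rewrite (sum_enum (fun h => L N h - nu h)) sumrB nu1.
    rewrite (bigD1 j)//= eqxx mulr1 big1 ?addr0; last first.
      by move=> i /negbTE ->; rewrite mulr0.
    under eq_bigr do rewrite mulrBl.
    by rewrite sumrB -nuS /y; ring.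
  have := congr1 (fun M : 'rV_#|H| => M ord0 (enum_rank k)) (mulmxK A_unit x).
  rewrite xA !mxE enum_rankK => /eqP; rewrite eq_sym subr_eq addrC => /eqP ->.
  by congr (_ + _); apply: eq_bigr => i _; rewrite mxE.
rewrite (_ : L ^~ k = fun N => nu k +
  \sum_(i < #|H|) y N (enum_val i) * invmx A i (enum_rank k)); last exact/funext.
have : \sum_(i < #|H|) y N (enum_val i) * invmx A i (enum_rank k) @[N --> \oo] -->
    \sum_(i < #|H|) 0 * invmx A i (enum_rank k).
  apply: cvg_big => [|i _]; first exact: add_continuous.
  by apply: cvgMr_tmp; exact: y0.
have -> : \sum_(i < #|H|) 0 * invmx A i (enum_rank k) = 0.
  by apply: big1 => i _; rewrite mul0r.
move=> S0; by have := cvgD (cvg_cst (nu k)) S0; rewrite addr0; apply.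
Qed.

End finite_state_chain.

(** * Visit frequencies of the chain *)

Lemma ae_forall_fin {d} {T : measurableType d} {R : realType}
    (mu : {measure set T -> \bar R}) (I : finType) (Q : I -> T -> Prop) :
  (forall i, {ae mu, forall x, Q i x}) -> {ae mu, forall x, forall i, Q i x}.
Proof.
move=> aeQ.
have : {ae mu, forall x, forall n, if unpickle n is Some i then Q i x else True}.
  apply/ae_foralln => n; case: (unpickle n) => [i|]; first exact: aeQ.
  exact: aeW.
by apply: filterS => x Qx i; have := Qx (pickle i); rewrite pickleK.
Qed.

Lemma measurable_discrete_fun {d d'} {K : finMeasurableType d}
    {T' : measurableType d'} (g : K -> T') : measurable_fun setT g.
Proof. by move=> _ Y _; exact: measurable_discrete. Qed.

Lemma measurable_fiber {d d'} {T : measurableType d} {K : finMeasurableType d'}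
    (Z : T -> K) : measurable_fun setT Z ->
  forall A, measurable (Z @^-1` A).
Proof.
move=> mZ A; rewrite -[X in measurable X]setTI.
by apply: mZ => //; exact: measurable_discrete.
Qed.

Lemma Rintegral_fiber {d} {T : measurableType d} {R : realType}
    (mu : {measure set T -> \bar R}) (K : finType) (Z : T -> K) (g : T -> R) :
  (forall k, measurable (Z @^-1` [set k])) -> mu.-integrable setT (EFin \o g) ->
  \int[mu]_x g x = \sum_k \int[mu]_(x in Z @^-1` [set k]) g x.
Proof.
move=> mZ ig.
have gE : \bigcup_(k in [set` index_enum K]) Z @^-1` [set k] = setT.
  by apply/seteqP; split => // x _; exists (Z x) => //=; rewrite mem_index_enum.
have int k : mu.-integrable (Z @^-1` [set k]) (EFin \o g).
  exact: integrableS ig.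
rewrite /Rintegral -gE bigcup_seq integral_bigsetU_EFin//.
- by rewrite sum_fine// => k _; exact: integrable_fin_num.
- exact: index_enum_uniq.
- apply/trivIsetP => i j _ _ /eqP ij; apply/seteqP; split => // x [/= zi zj].
  by apply: ij; rewrite -zi -zj.
- by rewrite -bigcup_seq gE; exact: measurable_int ig.
Qed.

Section markov_chain_frequencies.
Context {R : realType} {dO dH : measure_display} {Omega : measurableType dO}
  {P : probability Omega R} {H : finMeasurableType dH}.
Variables (w : H -> H -> R) (eta : {RV P >-> H}^nat).
Hypothesis wS : stochastic w.
Hypothesis etaM : forall t (h : nat -> H) h',
  (P [set om | (forall i, (i <= t)%N -> eta i om = h i) /\ eta t.+1 om = h'] =
   P [set om | forall i, (i <= t)%N -> eta i om = h i] * (w (h t) h')%:E)%E.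

(** The prediction error of the indicator of the next state. *)
Let innov k i om : R := (eta i.+1 om == k)%:R - w (eta i om) k.

Let m_eta i : measurable_fun setT (eta i).
Proof. exact: measurable_funPT. Qed.

Let m_innov k i : measurable_fun setT (innov k i).
Proof.
apply: measurable_funB.
  exact: (measurableT_comp (measurable_discrete_fun (fun h => (h == k)%:R : R))).
exact: (measurableT_comp (measurable_discrete_fun (fun h => w h k : R))).
Qed.

Let b_innov k i om : `|innov k i om| <= 1.
Proof.
have [w0 _] := wS; rewrite /innov ler_norml.
have := w0 (eta i om) k; have := stochastic_le1 _ wS (eta i om) k.
by case: (_ == _) => /=; lra.
Qed.

Let history t om : {ffun 'I_t.+1 -> H} := [ffun i : 'I_t.+1 => eta i om].

Let historyE t (c : {ffun 'I_t.+1 -> H}) :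
  history t @^-1` [set c] =
  [set om | forall i, (i <= t)%N -> eta i om = c (inord i)].
Proof.
apply/seteqP; split => om /= => [<- i it|h].
  by rewrite ffunE inordK.
by apply/ffunP => i; rewrite ffunE h ?inord_val// -ltnS.
Qed.

Let m_history t c : measurable (history t @^-1` [set c]).
Proof.
rewrite (_ : _ @^-1` _ = \big[setI/setT]_(i < t.+1) (eta i @^-1` [set c i])).
  by apply: bigsetI_measurable => i _; exact: measurable_fiber.
rewrite -bigcap_seq; apply/seteqP; split => om /=.
  by move=> <- i _ /=; rewrite ffunE.
by move=> h; apply/ffunP => i; rewrite ffunE; apply: h => /=; rewrite mem_index_enum.
Qed.

(** On the event that the chain follows a given path up to time j, the earlier
    innovation is constant and the later one has integral 0 by the Markov
    property. *)
Lemma markov_innovation_orthogonal k i j : (i < j)%N ->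
  \int[P]_om (innov k i om * innov k j om) = 0.
Proof.
move=> ij; rewrite (@Rintegral_fiber _ _ _ P _ (history j)); last first.
  apply: (bounded_integrable P _ (1 * 1)); first exact: measurable_funM.
  by move=> om; rewrite normrM ler_pM.
  exact: m_history.
apply: big1 => c _.
pose ci := (c (inord i.+1) == k)%:R - w (c (inord i)) k.
pose C := history j @^-1` [set c]; pose E := eta j.+1 @^-1` [set k].
have jE : inord j = ord_max :> 'I_j.+1 by apply/val_inj; rewrite /= inordK.
have mE : measurable E by exact: measurable_fiber.
have mC : measurable C by exact: m_history.
transitivity (\int[P]_(om in C) (ci * (\1_E om - w (c ord_max) k))).
  apply: eq_Rintegral => om; rewrite inE /C historyE => h.
  rewrite /innov (h i.+1)// (h i (ltnW ij)) (h j)// jE -/ci; congr (_ * (_ - _)).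
  by rewrite indicE; congr (nat_of_bool _)%:R; apply/eqP/idP; rewrite inE.
have i1 : P.-integrable C (EFin \o \1_E).
  exact: (integrableS measurableT mC (fun _ _ => I) (integrable_indic P mE)).
have i2 : P.-integrable C (EFin \o (fun=> w (c ord_max) k)).
  exact: finite_measure_integrable_cst.
rewrite RintegralZl//; last exact: EFin_integrableB.
rewrite RintegralB// Rintegral_cst//.
have -> : \int[P]_(om in C) \1_E om = fine (P (C `&` E)).
  by rewrite /Rintegral integral_indic// setIC.
have -> : P (C `&` E) = (P C * (w (c ord_max) k)%:E)%E.
  have := etaM j (fun i => c (inord i)) k; rewrite /C historyE.
  by rewrite jE => <-.
by rewrite fineM ?fin_num_measure//= [fine _ * _]mulrC subrr mulr0.
Qed.

Let sum_block_inv_lt r :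
  (\sum_(n <oo) ((block r n)%:R^-1 : R)%:E * 1 < +oo)%E.
Proof.
rewrite (@le_lt_trans _ _ (r.+2%:R%:E))// ?ltry//; apply: nneseries_le_bound.
  by move=> n; rewrite mule1 lee_fin invr_ge0.
move=> M; under eq_bigr do rewrite mule1.
rewrite sumEFin lee_fin -[X in _ <= X]divr1.
rewrite (le_trans _ (block_sum_inv _ r _ M ltr01))//.
rewrite [leRHS]big_mkcond/= ler_sum// => i _.
by rewrite ler1n block_gt0.
Qed.

Lemma ae_mean_innov0 k :
  {ae P, forall om, mean (innov k ^~ om) @ \oo --> (0 : R)}.
Proof.
apply: (orthogonal_strong_law P (innov k) _ _ _ 1 (fun=> 1%E)).
- exact: m_innov.
- by move=> i; exists 1 => om; exact: b_innov.
- by move=> i j; exact: markov_innovation_orthogonal.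
- by move=> i om; have := b_innov k i om; rewrite ler_norml => /andP[].
- move=> i; have -> : (1 = \int[P]_om (cst 1 om))%E.
    by rewrite integral_cst// mul1e; exact/esym/probability_setT.
  apply: ge0_le_integral => //.
  + by move=> om _; rewrite lee_fin sqr_ge0.
  + by apply/measurable_EFinP; exact: measurable_funX.
  + by move=> om _; rewrite lee_fin -(real_normK (num_real _)) expr_le1.
- by [].
- exact: sum_block_inv_lt.
Qed.

Hypothesis wI : irreducible w.
Variable nu : H -> R.
Hypothesis nu1 : \sum_h nu h = 1.
Hypothesis nuS : forall k, nu k = \sum_h nu h * w h k.

(** Averages of innovations vanish in the limit, so the frequencies are
    asymptotically invariant under w, up to the telescoping boundary term. *)
Lemma ae_frequency :
  {ae P, forall om, forall h,
    mean (fun i => (eta i om == h)%:R) @ \oo --> nu h}.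
Proof.
have : {ae P, forall om, forall k, mean (innov k ^~ om) @ \oo --> (0 : R)}.
  by apply: ae_forall_fin => k; exact: ae_mean_innov0.
apply: filterS => om inn.
apply: (stationary_attracts w wS wI nu nu1 nuS
  (fun N h => mean (fun i => (eta i om == h)%:R) N)).
  apply: (@cvg_trans _ (cst 1 @ \oo)); last exact: cvg_cst.
  apply: near_eq_cvg; exists 1%N => //= N N0.
  rewrite /mean -mulr_suml exchange_big/=.
  under eq_bigr => i _.
    rewrite (bigD1 (eta i om))//= eqxx big1 ?addr0; last first.
      by move=> h /negbTE; rewrite eq_sym => ->.
    over.
  by rewrite sumr_const card_ord divff// pnatr_eq0 -lt0n.
move=> k.
have N0 : (fun N => N%:R^-1 : R) @ \oo --> (0 : R).
  by rewrite -(cvg_shiftS (fun N : nat => N%:R^-1 : R)); exact: cvg_harmonic.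
have T0 : (fun N => ((eta 0%N om == k)%:R - (eta N om == k)%:R) / N%:R : R) @ \oo --> (0 : R).
  apply/norm_cvg0P; apply: (squeeze_cvgr _ (@cvg_cst _ (0 : R) _ _ _) N0).
  apply: nearW => N; rewrite normr_ge0 normrM normfV (@ger0_norm _ N%:R)//.
  rewrite -[leRHS]mul1r ler_wpM2r ?invr_ge0//.
  by case: (_ == _); case: (_ == _); rewrite ?subrr ?subr0 ?sub0r ?normrN ?normr1 ?normr0.
pose tel (N : nat) : R := ((eta 0%N om == k)%:R - (eta N om == k)%:R) / N%:R.
suff E N : mean (fun i => (eta i om == k)%:R) N -
    \sum_h mean (fun i => (eta i om == h)%:R) N * w h k =
    mean (innov k ^~ om) N + tel N.
  by rewrite (eq_cvg _ _ E); have := cvgD (inn k) T0; rewrite addr0; apply.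
rewrite /mean /tel -mulrDl.
have -> : \sum_h (\sum_(i < N) (eta i om == h)%:R) / N%:R * w h k =
    (\sum_(i < N) w (eta i om) k) / N%:R.
  under eq_bigr do rewrite mulrAC mulr_suml.
  rewrite -mulr_suml exchange_big/=; congr (_ / _); apply: eq_bigr => i _.
  rewrite (bigD1 (eta i om))//= eqxx mul1r big1 ?addr0// => h /negbTE.
  by rewrite eq_sym => ->; rewrite mul0r.
rewrite -mulrBl sumrB; congr (_ / _).
have -> : \sum_(i < N) (eta i.+1 om == k)%:R =
    \sum_(i < N) (eta i om == k)%:R + (eta N om == k)%:R - (eta 0%N om == k)%:R :> R.
  elim: N => [|N ih]; first by rewrite !big_ord0 add0r subrr.
  by rewrite !big_ord_recr/= ih; ring.
ring.
Qed.

End markov_chain_frequencies.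

(** * Integrals under conditional independence *)

Section integral_restricted.
Context {d} {T : measurableType d} {R : realType}.
Variables (mu : {finite_measure set T -> \bar R}) (C : set T).
Hypothesis mC : measurable C.

Lemma Rintegral_mrestr (g : T -> R) (M : R) : measurable_fun setT g ->
  (forall x, `|g x| <= M) ->
  \int[mu]_(x in C) g x = \int[mrestr mu mC]_x g x.
Proof.
move=> mg gM; have Coo : (mu C < +oo)%E by rewrite ltey_eq fin_num_measure.
have ig := bounded_integrable (mfrestr mC Coo) g M mg gM.
rewrite /Rintegral (negligible_integral (measurableC mC) measurableT ig).
  rewrite setTD setCK; congr fine.
  apply: eq_measure_integral => A mA AC; rewrite /mfrestr /mrestr.
  by congr (mu _); apply/esym/setIidPl.
by rewrite /= /mfrestr /mrestr setICl measure0.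
Qed.

End integral_restricted.

Section integral_independent.
Context {d d1 d2} {T : measurableType d} {S1 : measurableType d1}
  {S2 : measurableType d2} {R : realType}.
Variables (P : probability T R) (C : set T) (Y : T -> S1) (Z : T -> S2)
  (kap : probability S2 R).
Hypotheses (mC : measurable C) (mY : measurable_fun setT Y)
  (mZ : measurable_fun setT Z).
Hypothesis YZ : forall A B, measurable A -> measurable B ->
  (P (Y @^-1` A `&` Z @^-1` B `&` C) = P (Y @^-1` A `&` C) * kap B)%E.

(** On the event C the joint law of (Y, Z) agrees on rectangles with the product
    of the law of Y on C and kap, hence is this product, and Fubini's theorem
    applies. *)
Lemma Rintegral_independent (g : S1 -> R) (u : S2 -> R) (M : R) :
  measurable_fun setT g -> measurable_fun setT u ->
  (forall y, `|g y| <= M) -> (forall z, `|u z| <= M) ->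
  \int[P]_(om in C) (g (Y om) * u (Z om)) =
  \int[P]_(om in C) g (Y om) * \int[kap]_z u z.
Proof.
move=> mg mu gM uM.
have M0 : 0 <= M by exact: le_trans (normr_ge0 _) (gM point).
have Coo : (P C < +oo)%E by rewrite ltey_eq fin_num_measure.
pose r : {finite_measure set T -> \bar R} := mfrestr mC Coo.
have mYZ : measurable_fun setT (fun om => (Y om, Z om)) by exact: measurable_fun_pair.
pose nY : {measure set S1 -> \bar R} :=
  measure_function_pushforward__canonical__measure_function_Measure r mY.
have fY : fin_num_fun nY.
  move=> A mA; apply: fin_num_measure.
  by rewrite -[X in measurable X]setTI; exact: mY.
pose nYf := HB.pack_for {finite_measure set S1 -> \bar R}
  (nY : set _ -> \bar R) (Measure.class nY) (Measure_isFinite.Build _ _ _ nY fY).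
pose nYZ : {measure set (S1 * S2) -> \bar R} :=
  measure_function_pushforward__canonical__measure_function_Measure r mYZ.
pose F (x : S1 * S2) := g x.1 * u x.2.
have mF : measurable_fun setT F.
  by apply: measurable_funM; apply: measurableT_comp.
have FM x : `|F x| <= M * M by rewrite normrM ler_pM.
have prodE A : measurable A -> ((nYf \x kap) A = nYZ A)%E.
  move=> mA; apply: product_measure_unique; last by [].
  move=> A' B' mA' mB'.
  by rewrite /nYZ /nYf/= /pushforward /mfrestr /mrestr/= -YZ.
have mFYZ : measurable_fun setT (F \o (fun om => (Y om, Z om))).
  exact: measurableT_comp.
have mgY : measurable_fun setT (g \o Y) by exact: measurableT_comp.
have iFYZ := bounded_integrable r _ (M * M) mFYZ (fun om => FM _).
have igY := bounded_integrable r _ M mgY (fun om => gM _).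
have -> : \int[P]_(om in C) (g (Y om) * u (Z om)) = fine (\int[nYZ]_x (F x)%:E)%E.
  rewrite (Rintegral_mrestr P C mC _ (M * M) mFYZ) => [|om]; last exact: FM.
  congr fine; rewrite (integral_pushforward mYZ)//; first exact/measurable_EFinP.
have -> : \int[P]_(om in C) g (Y om) = fine (\int[nYf]_x (g x)%:E)%E.
  rewrite (Rintegral_mrestr P C mC _ M mgY) => [|om]; last exact: gM.
  congr fine; rewrite (integral_pushforward mY)//; first exact/measurable_EFinP.
rewrite /Rintegral.
have -> : (\int[nYZ]_x (F x)%:E = \int[nYf \x kap]_x (F x)%:E)%E.
  by apply: eq_measure_integral => A mA _; exact/esym/prodE.
have iF : (nYf \x kap)%E.-integrable setT (EFin \o F).
  have iF : nYZ.-integrable setT (EFin \o F).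
    by apply: integrable_pushforward => //; exact/measurable_EFinP.
  apply/integrableP; split; first exact/measurable_EFinP.
  rewrite (eq_measure_integral nYZ) => [|A mA _]; last exact: prodE.
  by have /integrableP[] := iF.
rewrite -(integral12_prod_meas1 iF) /fubini_F/=.
have ku : (\int[kap]_z (u z)%:E)%E \is a fin_num.
  apply: integrable_fin_num => //; exact: (bounded_integrable kap u M).
under eq_integral => x _.
  rewrite /F/=; under eq_integral do rewrite EFinM.
  rewrite integralZl//=; last exact: (bounded_integrable kap u M).
  over.
rewrite -(fineK ku) integralZr//; last exact: (bounded_integrable nYf g M).
rewrite fineM//.
by apply: integrable_fin_num => //; exact: (bounded_integrable nYf g M).
Qed.

End integral_independent.

(** * The stationary law as a mixture *)

Lemma measurable_fun_finite_snd {d d' d''} {T : measurableType d}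
    {K : finMeasurableType d'} {U : measurableType d''} (u : T -> K -> U) :
  (forall k, measurable_fun setT (u ^~ k)) ->
  measurable_fun setT (fun z : T * K => u z.1 z.2).
Proof.
move=> mu _ Y mY; rewrite setTI.
rewrite (_ : _ @^-1` _ = \big[setU/set0]_(k : K) ((u ^~ k @^-1` Y) `*` [set k])).
  apply: bigsetU_measurable => k _; apply: measurableX.
    by rewrite -[X in measurable X]setTI; exact: mu.
  exact: measurable_discrete.
rewrite -bigcup_seq; apply/seteqP; split=> [[x h] /= Yx|[x h] [k _ [/= Yx ->]]//].
by exists h => //=; rewrite mem_index_enum.
Qed.

Lemma ge0_integral_finite {d} {K : finMeasurableType d} {R : realType}
    (mu : {measure set K -> \bar R}) (c : K -> \bar R) :
  (forall k, 0 <= c k)%E ->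
  (\int[mu]_k c k = \sum_k c k * mu [set k])%E.
Proof.
move=> c0.
have gE : \big[setU/set0]_(k <- index_enum K) [set k] = [set: K].
  by rewrite -bigcup_seq; apply/seteqP; split => // x _; exists x => //=; rewrite mem_index_enum.
rewrite -[in LHS]gE ge0_integral_bigsetU//.
- apply: eq_bigr => k _; rewrite (eq_integral (cst (c k))).
    by rewrite integral_cst//; exact: measurable_discrete.
  by move=> x; rewrite inE => ->.
- by move=> k; exact: measurable_discrete.
- exact: index_enum_uniq.
- by apply/trivIsetP => i j _ _ /eqP ij; apply/seteqP; split => // x [/= -> /ij].
- by rewrite gE; exact: measurable_discrete_fun.
Qed.

Section conditional_law.
Context {R : realType} {dH : measure_display} {H : finMeasurableType dH} {d : nat}
  {Xi : set 'rV[R]_d}.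
Variable q : H -> density Xi.
Local Open Scope ereal_scope.

(** The law of a data pair whose state is h; taking a Dirac mass for the
    stationary distribution makes it a probability on the same space as the
    stationary law. *)
Definition cond_law (h : H) : probability ('rV[R]_d * H)%type R :=
  stationary_law (\d_h) q.

Let patched (A : set ('rV[R]_d * H)) h (x : 'rV[R]_d) : \bar R :=
  if (x, h) \in A then (q h x)%:E else 0.

Let patched_ge0 A h x : 0 <= patched A h x.
Proof.
by rewrite /patched; case: ifPn => // _; rewrite lee_fin; exact: density_ge0 (densityP _) _.
Qed.

Lemma stationary_lawE_integral (nu : probability H R) A : measurable A ->
  stationary_law nu q A = \int[nu]_h \int[@lebesgue_rV R d]_x patched A h x.
Proof.
move=> mA; rewrite /stationary_law integral_mkcond fubini_tonelli2.
- by apply: eq_integral => h _; apply: eq_integral => x _; rewrite patchE.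
- apply/(measurable_restrictT _ mA); apply: measurable_funTS; apply/measurable_EFinP.
  apply: (measurable_fun_finite_snd (fun x h => q h x)) => h.
  exact: (density_measurable (densityP _)).
- by move=> [x h]; rewrite patchE; exact: patched_ge0.
Qed.

Let cond_lawE h A : measurable A ->
  cond_law h A = \int[@lebesgue_rV R d]_x patched A h x.
Proof.
move=> mA; rewrite /= stationary_lawE_integral// integral_dirac//.
  by rewrite diracT mul1e.
exact: measurable_discrete_fun.
Qed.

Lemma stationary_lawE (nu : probability H R) A : measurable A ->
  stationary_law nu q A = \sum_h cond_law h A * nu [set h].
Proof.
move=> mA; rewrite stationary_lawE_integral// ge0_integral_finite.
  by apply: eq_bigr => h _; rewrite cond_lawE.
by move=> h; apply: integral_ge0 => x _; exact: patched_ge0.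
Qed.

Lemma cond_law_slice h A : measurable A ->
  cond_law h A = \int[@lebesgue_rV R d]_(x in ysection A h) (q h x)%:E.
Proof.
move=> mA; rewrite cond_lawE// [RHS]integral_mkcond.
by apply: eq_integral => x _; rewrite patchE /patched mem_ysection.
Qed.

Lemma cond_law_fiber h : cond_law h (snd @^-1` [set h]) = 1.
Proof.
rewrite cond_law_slice; last first.
  by rewrite -[X in measurable X]setTI; apply: measurable_snd => //; exact: measurable_discrete.
rewrite (_ : ysection _ _ = setT).
  exact: (density_mass (densityP (q h))).
by apply/seteqP; split => // x _; rewrite /ysection/= inE.
Qed.

End conditional_law.

(** * The law of the data *)

Lemma fin_num_mulIe {R : realType} (x y p : \bar R) :
  (x \is a fin_num -> y \is a fin_num -> p \is a fin_num -> p != 0 ->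
   x * p = y * p -> x = y)%E.
Proof.
by move: x y p => [x||] [y||] [p||]// _ _ _ p0 [] /mulIf ->.
Qed.

(** Transfers integrability from the stationary law to the law of one data
    pair. *)
Lemma ge0_integral_le_mscale {d d'} {T : measurableType d} {S : measurableType d'}
    {R : realType} (mu : {measure set T -> \bar R}) (pi : {measure set S -> \bar R})
    (Z : T -> S) (K : R) (u : S -> \bar R) :
  measurable_fun setT Z -> 0 <= K ->
  (forall A, measurable A -> mu (Z @^-1` A) <= K%:E * pi A)%E ->
  measurable_fun setT u -> (forall z, 0 <= u z)%E ->
  (\int[mu]_x u (Z x) <= K%:E * \int[pi]_z u z)%E.
Proof.
move=> mZ K0 muK mu_ u0.
pose nu : {measure set S -> \bar R} :=
  measure_function_pushforward__canonical__measure_function_Measure mu mZ.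
have -> : (\int[mu]_x u (Z x) = \int[nu]_z u z)%E.
  by rewrite (ge0_integral_pushforward mZ).
rewrite -[K]/((NngNum K0)%:num) -ge0_integral_mscale//.
exact: ge0_le_measure_integral.
Qed.

Lemma ge0_Rintegral_msum {d} {T : measurableType d} {R : realType} {K : finType}
    (mu : {measure set T -> \bar R}) (m : K -> {measure set T -> \bar R})
    (c : K -> R) (u : T -> \bar R) : (forall k, 0 <= c k) ->
  (forall A, measurable A -> mu A = \sum_k (c k)%:E * m k A)%E ->
  measurable_fun setT u -> (forall z, 0 <= u z)%E ->
  (\int[mu]_x u x = \sum_k (c k)%:E * \int[m k]_x u x)%E.
Proof.
move=> c0 muE mu_ u0.
have [k0 _|K0] := pickP (@predT K); last first.
  have E0 (F : K -> \bar R) : (\sum_k F k = 0)%E.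
    by apply: big1 => k _; have := K0 k.
  rewrite E0 (eq_measure_integral mzero) ?integral_measure_zero// => A mA _.
  by rewrite muE// E0.
pose m_ (i : nat) : {measure set T -> \bar R} :=
  mscale (NngNum (c0 (nth k0 (index_enum K) i))) (m (nth k0 (index_enum K) i)).
rewrite (eq_measure_integral (msum m_ (size (index_enum K)))); last first.
  by move=> A mA _; rewrite muE// (big_nth k0) big_mkord.
rewrite ge0_integral_measure_sum// (big_nth k0) big_mkord.
by apply: eq_bigr => i _; rewrite ge0_integral_mscale.
Qed.

Section data_law.
Context {R : realType} {dO dH : measure_display} {Omega : measurableType dO}
  {P : probability Omega R} {H : finMeasurableType dH} {d : nat}
  {Xi : set 'rV[R]_d}.
Variables (w : H -> H -> R) (q : H -> density Xi)
  (xi : {RV P >-> 'rV[R]_d}^nat) (eta : {RV P >-> H}^nat).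
Hypothesis data : data_process w q xi eta.

Let Z i om := (xi i om, eta i om).

Lemma measurable_data i : measurable_fun setT (Z i).
Proof. by apply: measurable_fun_pair; exact: measurable_funPT. Qed.

Let fiberE t h B : Z t @^-1` B `&` eta t @^-1` [set h] =
  xi t @^-1` (ysection B h) `&` eta t @^-1` [set h].
Proof.
apply/seteqP; split => om /= [h1 h2]; split => //.
  by rewrite /ysection/= inE -h2.
by move: h1; rewrite /ysection/= inE -h2.
Qed.

Lemma data_law_fiber t h B : measurable B ->
  (P (Z t @^-1` B `&` eta t @^-1` [set h]) =
   P (eta t @^-1` [set h]) * cond_law q h B)%E.
Proof.
move=> mB; rewrite fiberE (data_density data); last exact: measurable_ysection.
by rewrite cond_law_slice.
Qed.

(** Given the state at time t, the pair at time t has the law [cond_law] and is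
    independent of each earlier pair.  Conditional independence is a product
    formula multiplied by the probability of the conditioning event, which is
    cancelled unless it is 0. *)
Lemma data_law_independent j t h A B : (j < t)%N -> measurable A -> measurable B ->
  (P (Z j @^-1` A `&` Z t @^-1` B `&` eta t @^-1` [set h]) =
   P (Z j @^-1` A `&` eta t @^-1` [set h]) * cond_law q h B)%E.
Proof.
move=> jt mA mB; set C := eta t @^-1` [set h].
have mC : measurable C by exact: measurable_fiber.
have mZ k D : measurable D -> measurable (Z k @^-1` D).
  by move=> mD; rewrite -[X in measurable X]setTI; exact: measurable_data.
have FB : sigma_rv (xi t) (xi t @^-1` (ysection B h)).
  by exists (ysection B h); rewrite ?setTI//; exact: measurable_ysection.
have GA : g_sigma_preimage (fun (i : 'I_t) om => (xi i om, eta i om)) (Z j @^-1` A).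
  apply: sub_sigma_algebra; rewrite -bigcup_seq/=; exists (Ordinal jt) => /=.
    by rewrite mem_index_enum.
  by exists A => //; rewrite setTI.
have /= := data_past data h FB GA.
have fE := fiberE t h B; rewrite -/C in fE *.
have S : Z j @^-1` A `&` Z t @^-1` B `&` C =
    xi t @^-1` (ysection B h) `&` Z j @^-1` A `&` C.
  by rewrite -setIA fE setIA (setIC (Z j @^-1` A)).
rewrite -S -fE.
rewrite data_law_fiber// -/C => E.
have [PC0|PC0] := eqVneq (P C) 0%E.
  have P0 D : measurable D -> P (D `&` C) = 0%E.
    move=> mD; apply/eqP; rewrite eq_le measure_ge0 andbT -PC0.
    by apply: le_measure; rewrite ?inE//; exact: measurableI.
  by rewrite !P0 ?mul0e//; [exact: mZ|apply: measurableI; exact: mZ].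
have fC : P C \is a fin_num by exact: fin_num_measure.
apply: (fin_num_mulIe _ _ (P C)) => //.
- by apply: fin_num_measure; apply: measurableI => //; apply: measurableI; exact: mZ.
- by rewrite fin_numM// ?fin_num_measure//; apply: measurableI => //; exact: mZ.
- by rewrite E muleAC [RHS]muleAC; congr (_ * _)%E; rewrite muleC.
Qed.

Lemma data_law t B : measurable B ->
  (P (Z t @^-1` B) = \sum_h P (eta t @^-1` [set h]) * cond_law q h B)%E.
Proof.
move=> mB; have mZB : measurable (Z t @^-1` B).
  by rewrite -[X in measurable X]setTI; exact: measurable_data.
under eq_bigr do rewrite -data_law_fiber//.
have gE : \bigcup_(h in [set` index_enum H])
    (Z t @^-1` B `&` eta t @^-1` [set h]) = Z t @^-1` B.
  apply/seteqP; split => [x [h _ []]//|x Bx].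
  by exists (eta t x) => //=; rewrite mem_index_enum.
rewrite -[in LHS]gE measure_fin_bigcup//.
- by rewrite -fsbig_seq ?index_enum_uniq.
- apply/trivIsetP => i j _ _ /eqP ij; apply/seteqP; split => // x [/= [_ zi] [_ zj]].
  by apply: ij; rewrite -zi -zj.
- by move=> h _; apply: measurableI => //; exact: measurable_fiber.
Qed.

(** A function of the current pair with conditional mean 0 in every state is
    orthogonal to every function of an earlier pair. *)
Lemma data_orthogonal j t (g u : 'rV[R]_d * H -> R) (M : R) : (j < t)%N ->
  measurable_fun setT g -> measurable_fun setT u ->
  (forall z, `|g z| <= M) -> (forall z, `|u z| <= M) ->
  (forall h, \int[cond_law q h]_z u z = 0) ->
  \int[P]_om (g (Z j om) * u (Z t om)) = 0.
Proof.
move=> jt mg mu gM uM u0.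
have mgZ : measurable_fun setT (fun om => g (Z j om) * u (Z t om)).
  by apply: measurable_funM; apply: measurableT_comp => //; exact: measurable_data.
rewrite (@Rintegral_fiber _ _ _ P _ (eta t)); last first.
- by apply: (bounded_integrable P _ (M * M)) => // om; rewrite normrM ler_pM.
- by move=> h; exact: measurable_fiber.
apply: big1 => h _.
rewrite (Rintegral_independent P _ (Z j) (Z t) (cond_law q h) _ _ _ _ _ _ M)//.
- by rewrite u0 mulr0.
- exact: measurable_fiber.
- exact: measurable_data.
- exact: measurable_data.
- by move=> A B mA mB; exact: data_law_independent.
Qed.

End data_law.

(** * The strong law of large numbers for the data *)

Section law_of_large_numbers.
Context {R : realType} {dO dH : measure_display} {Omega : measurableType dO}
  {P : probability Omega R} {H : finMeasurableType dH} {d : nat}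
  {Xi : set 'rV[R]_d}.
Variables (w : H -> H -> R) (q : H -> density Xi)
  (xi : {RV P >-> 'rV[R]_d}^nat) (eta : {RV P >-> H}^nat).
Hypothesis data : data_process w q xi eta.
Variable nu : probability H R.
Hypothesis nu_stationary : stationary w nu.
Hypothesis wI : irreducible w.

Let Z i om := (xi i om, eta i om).
Let pi := stationary_law nu q.
Let kap := cond_law q.
Let n h := fine (nu [set h]).

Let nuE h : nu [set h] = (n h)%:E.
Proof. by rewrite fineK// fin_num_measure//; exact: measurable_discrete. Qed.

Let n1 : \sum_h n h = 1.
Proof.
apply: EFin_inj; rewrite -sumEFin -(probability_setT nu).
have := ge0_integral_finite nu (fun=> 1%E) (fun _ => lee01).
rewrite integral_cst// mul1e => ->.
by apply: eq_bigr => h _; rewrite mul1e; exact/esym/nuE.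
Qed.

Let nS k : n k = \sum_h n h * w h k.
Proof.
apply: EFin_inj; rewrite -nuE nu_stationary -sumEFin.
by apply: eq_bigr => h _; rewrite EFinM; congr (_ * _)%E; exact: nuE.
Qed.

Let n_ge0 h : 0 <= n h. Proof. exact: fine_ge0. Qed.

Let n_gt0 h : 0 < n h.
Proof. exact: (stationary_gt0 w (data_stochastic data) wI n n_ge0 n1 nS). Qed.

(** Every state has positive stationary mass, so both the conditional laws and
    the law of any data pair are at most K times the stationary law. *)
Let K := \sum_h (n h)^-1.

Let K_ge0 : 0 <= K.
Proof. by apply: sumr_ge0 => h _; rewrite invr_ge0. Qed.

Let Kn h : 1 <= K * n h.
Proof.
rewrite -(mulVf (lt0r_neq0 (n_gt0 h))) ler_wpM2r// /K (bigD1 h)//= lerDl.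
by apply: sumr_ge0 => k _; rewrite invr_ge0.
Qed.

Let piE A : measurable A -> (pi A = \sum_h (n h)%:E * kap h A)%E.
Proof.
move=> mA; rewrite /pi stationary_lawE//.
by apply: eq_bigr => h _; rewrite muleC nuE.
Qed.

Let kap_le h A : measurable A -> (kap h A <= K%:E * pi A)%E.
Proof.
move=> mA; rewrite piE//.
apply: (@le_trans _ _ (K%:E * ((n h)%:E * kap h A))%E); last first.
  rewrite lee_wpmul2l// (bigD1 h)//= leeDl// sume_ge0// => k _.
  by rewrite mule_ge0 ?lee_fin.
by rewrite muleA -EFinM -[leLHS]mul1e lee_wpmul2r// lee_fin.
Qed.

Let law_le t A : measurable A -> (P (Z t @^-1` A) <= K%:E * pi A)%E.
Proof.
move=> mA; rewrite (data_law w q xi eta data)// piE// ge0_sume_distrr; last first.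
  by move=> h _; rewrite mule_ge0 ?lee_fin.
apply: lee_sum => h _; rewrite muleA lee_wpmul2r// -EFinM.
rewrite (@le_trans _ _ 1%E)// ?lee_fin//; apply: probability_le1.
exact: measurable_fiber.
Qed.

Section nonnegative.
Variable phi : 'rV[R]_d * H -> R.
Hypothesis mphi : measurable_fun setT phi.
Hypothesis phi0 : forall z, 0 <= phi z.
Hypothesis iphi : pi.-integrable setT (EFin \o phi).

(** Truncation of phi at a level growing with the time i. *)
Let tr (i : nat) z : R := if phi z <= i%:R then phi z else 0.

Let m_tr i : measurable_fun setT (tr i).
Proof.
apply: measurable_fun_ifT => //.
exact: measurable_fun_ler.
Qed.

Let tr_ge0 i z : 0 <= tr i z.
Proof. by rewrite /tr; case: ifPn. Qed.

Let tr_le i z : tr i z <= i%:R.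
Proof. by rewrite /tr; case: ifPn. Qed.

Let tr_phi i z : tr i z <= phi z.
Proof. by rewrite /tr; case: ifPn. Qed.

Let tr_mono z : {homo tr ^~ z : i j / (i <= j)%N >-> i <= j}.
Proof.
move=> i j ij; rewrite /tr; case: ifPn => [pi_|_].
  by rewrite ifT// (le_trans pi_)// ler_nat.
by case: ifPn.
Qed.

Let itr i h : (kap h).-integrable setT (EFin \o tr i).
Proof.
by apply: (bounded_integrable (kap h) _ i%:R) => // z; rewrite ger0_norm.
Qed.

Let iphik h : (kap h).-integrable setT (EFin \o phi).
Proof.
apply/integrableP; split; first exact/measurable_EFinP.
under eq_integral do rewrite gee0_abs ?lee_fin//.
have h1 := ge0_integral_le_mscale (kap h) pi id K (EFin \o phi)
  (@measurable_id _ _ _) K_ge0 (kap_le h).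
apply: le_lt_trans (h1 _ _) _.
- exact/measurable_EFinP.
- by move=> z; rewrite lee_fin.
rewrite lte_mul_pinfty// ?lee_fin//.
exact: (integrable_lty measurableT iphi).
Qed.

Let mt i h := \int[kap h]_z tr i z.
Let m h := \int[kap h]_z phi z.

Let mt_ge0 i h : 0 <= mt i h.
Proof. exact: Rintegral_ge0. Qed.

Let mt_le i h : mt i h <= i%:R.
Proof.
have ic : (kap h).-integrable setT (EFin \o cst i%:R).
  exact: finite_measure_integrable_cst.
have := le_Rintegral measurableT (itr i h) ic (fun z _ => tr_le i z).
rewrite Rintegral_cst// [X in _ * X](_ : _ = 1) ?mulr1//.
exact: (congr1 fine (probability_setT (kap h))).
Qed.

Let mt_m i h : mt i h <= m h.
Proof. exact: (le_Rintegral measurableT (itr i h) (iphik h) (fun z _ => tr_phi i z)). Qed.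

Let m_ge0 h : 0 <= m h.
Proof. exact: Rintegral_ge0. Qed.

Let mt_cvg h : mt ^~ h @ \oo --> m h.
Proof.
have tphi z : (tr j z)%:E @[j --> \oo] --> (phi z)%:E.
  apply: cvg_EFin; first exact: nearW.
  apply: (@cvg_trans _ (cst (phi z) @ \oo)); last exact: cvg_cst.
  apply: near_eq_cvg; exists (Num.trunc (phi z)).+1 => //= j jz.
  rewrite /tr ifT// (le_trans (ltW (truncnS_gt _)))// ler_nat.
  exact: jz.
have tr_abs i z : (`|(tr i z)%:E| <= (phi z)%:E)%E.
  by rewrite gee0_abs lee_fin.
have [_ _] := @dominated_convergence _ _ _ (kap h) setT measurableT
  (fun i => EFin \o tr i) (EFin \o phi) (EFin \o phi)
  (fun i => measurable_int _ (itr i h)) (measurable_int _ (iphik h))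
  (aeW _ (fun z _ => tphi z)) (iphik h)
  (aeW _ (fun z i _ => tr_abs i z)).
move=> C; apply: (@fine_cvg _ _ _ _ _ (m h)).
by rewrite /m /Rintegral fineK//; exact: (integrable_fin_num measurableT (iphik h)).
Qed.

Let b := \sum_h m h.

Let m_b h : m h <= b.
Proof. by rewrite /b (bigD1 h)//= lerDl sumr_ge0. Qed.

Let b_ge0 : 0 <= b. Proof. exact: sumr_ge0. Qed.

(** Centring by the conditional mean given the state leaves orthogonal
    increments, bounded below by - b whatever the truncation level. *)
Let cen i (z : 'rV[R]_d * H) := tr i z - mt i z.2.

Let m_cen i : measurable_fun setT (cen i).
Proof.
apply: measurable_funB => //; apply: measurableT_comp => //.
exact: measurable_discrete_fun.
Qed.

Let cen_abs i z : `|cen i z| <= i%:R.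
Proof.
rewrite /cen ler_norml; have := tr_ge0 i z; have := tr_le i z.
by have := mt_ge0 i z.2; have := mt_le i z.2; lra.
Qed.

Let cen_mean0 i h : \int[kap h]_z cen i z = 0.
Proof.
have ic : (kap h).-integrable setT (EFin \o cst (mt i h)).
  exact: finite_measure_integrable_cst.
transitivity (\int[kap h]_z (tr i z - cst (mt i h) z)).
  rewrite /Rintegral; apply: (congr1 fine).
  have mE : measurable (snd @^-1` [set h] : set ('rV[R]_d * H)).
    by rewrite -[X in measurable X]setTI; apply: measurable_snd => //; exact: measurable_discrete.
  apply: ae_eq_integral.
  - exact: measurableT.
  - by apply/measurable_EFinP; exact: m_cen.
  - by apply/measurable_EFinP; apply: measurable_funB.
  - exists (~` (snd @^-1` [set h])); split.
    + exact: measurableC.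
    + have := probability_setC (kap h) mE; rewrite (cond_law_fiber q h) subee//.
    + by move=> z /=; apply: contra_not => /= <- _; rewrite /cen.
rewrite (RintegralB measurableT (itr i h) ic) Rintegral_cst//.
rewrite [X in _ - _ * X](_ : _ = 1) ?mulr1 ?subrr//.
exact: (congr1 fine (probability_setT (kap h))).
Qed.

Let X i om := cen i (Z i om).

Let m_X i : measurable_fun setT (X i).
Proof. by apply: measurableT_comp => //; exact: measurable_data. Qed.

(** A nondecreasing bound on the second moments: the truncated function and its
    conditional mean are nonnegative, so the square of their difference is at
    most the sum of their squares. *)
Let V (i : nat) : \bar R := (K%:E * \int[pi]_z (tr i z ^+ 2)%:E + (b ^+ 2)%:E)%E.

Let m_trsq i : measurable_fun setT (fun z => (tr i z ^+ 2)%:E).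
Proof. by apply/measurable_EFinP; exact: measurable_funX. Qed.

Let X_V i : (\int[P]_om (X i om ^+ 2)%:E <= V i)%E.
Proof.
have h1 := ge0_integral_le_mscale P pi (Z i) K (fun z => (tr i z ^+ 2)%:E)
  (measurable_data xi eta i) K_ge0 (law_le i) (m_trsq i) (fun z => sqr_ge0 (tr i z)).
have mZ : measurable_fun setT (Z i) by exact: measurable_data.
have h2 : (\int[P]_om (b ^+ 2)%:E = (b ^+ 2)%:E)%E.
  by rewrite integral_cst// [X in (_ * X)%E](_ : _ = 1%E) ?mule1//; exact: probability_setT.
rewrite /V -h2; apply: le_trans (leeD2r _ h1).
rewrite -ge0_integralD//; first last.
- by move=> om _; rewrite lee_fin sqr_ge0.
- exact: (measurableT_comp (m_trsq i)).
- by move=> om _; rewrite lee_fin sqr_ge0.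
apply: ge0_le_integral => //.
- by move=> om _; rewrite lee_fin sqr_ge0.
- by apply/measurable_EFinP; exact: measurable_funX.
- by apply: emeasurable_funD => //; exact: (measurableT_comp (m_trsq i)).
- move=> om _; rewrite -EFinD lee_fin /X /cen.
  have := tr_ge0 i (Z i om); have := mt_ge0 i (eta i om).
  have := le_trans (mt_m i (eta i om)) (m_b (eta i om)) => /=.
  set x := tr _ _; set y := mt _ _; nra.
Qed.

Let V_mono : {homo V : i j / (i <= j)%N >-> (i <= j)%E}.
Proof.
move=> i j ij; rewrite /V leeD2r// lee_wpmul2l ?lee_fin//.
apply: ge0_le_integral => //.
- by move=> z _; rewrite lee_fin sqr_ge0.
- by move=> z _; rewrite lee_fin lerXn2r// ?nnegrE// tr_mono.
Qed.

(** Only the blocks with phi z <= block r k contribute, so the sum is at most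
    (phi z)^2 times (r + 2) / phi z.  This is where a first moment of phi is
    enough to control truncated second moments. *)
Let block_tr r z M : \sum_(k < M) (block r k)%:R^-1 * tr (block r k) z ^+ 2 <=
  r.+2%:R * phi z.
Proof.
have [pz|pz] := ltP 0 (phi z); last first.
  have p0 : phi z = 0 by apply/eqP; rewrite eq_le pz phi0.
  rewrite p0 mulr0 big1// => k _.
  by rewrite /tr p0; case: ifPn; rewrite expr0n mulr0.
apply: (@le_trans _ _ (phi z ^+ 2 * (r.+2%:R / phi z))); last first.
  by rewrite expr2 mulrCA -mulrA divff ?mulr1// gt_eqF.
apply: le_trans (ler_wpM2l (sqr_ge0 _) (block_sum_inv _ r _ M pz)).
rewrite mulr_sumr [leRHS]big_mkcond/=; apply: ler_sum => k _.
by rewrite /tr; case: ifPn => _; rewrite ?expr0n ?mulr0// mulrC.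
Qed.

Let V_sum r : (\sum_(k <oo) ((block r k)%:R^-1)%:E * V (block r k) < +oo)%E.
Proof.
pose c k : R := (block r k)%:R^-1.
have c0 k : 0 <= c k by rewrite invr_ge0.
pose I k := \int[pi]_z (tr k z ^+ 2).
have IE k : (\int[pi]_z (tr k z ^+ 2)%:E = (I k)%:E)%E.
  rewrite /I /Rintegral fineK//; apply: integrable_fin_num => //.
  apply: (bounded_integrable pi _ (k%:R ^+ 2)); first exact: measurable_funX.
  by move=> z; rewrite normrX lerXn2r ?nnegrE// ger0_norm.
pose J := \int[pi]_z phi z.
have JE : (\int[pi]_z (phi z)%:E = J%:E)%E.
  by rewrite /J /Rintegral fineK//; exact: integrable_fin_num.
have sumI M : \sum_(k < M) c k * I (block r k) <= r.+2%:R * J.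
  rewrite -lee_fin -sumEFin EFinM -JE.
  under eq_bigr do rewrite EFinM -IE.
  have mEphi : measurable_fun setT (EFin \o phi) by exact/measurable_EFinP.
  have -> : (r.+2%:R%:E * \int[pi]_z (phi z)%:E =
      \int[pi]_z (r.+2%:R%:E * (phi z)%:E))%E.
    by rewrite ge0_integralZl// => z _; rewrite lee_fin.
  under eq_bigr => k _.
    rewrite -ge0_integralZl//; [|by move=> z _; rewrite lee_fin sqr_ge0|by rewrite lee_fin].
    over.
  rewrite -ge0_integral_sum//; last 2 first.
  - move=> k; exact: measurable_funeM.
  - by move=> k z _; rewrite mule_ge0// lee_fin ?sqr_ge0.
  apply: ge0_le_integral => //.
  - by move=> z _; apply: sume_ge0 => k _; rewrite mule_ge0// lee_fin ?sqr_ge0.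
  - by apply: emeasurable_sum => k; exact: measurable_funeM.
  - exact: measurable_funeM.
  - move=> z _; under eq_bigr do rewrite -EFinM.
    by rewrite sumEFin -EFinM lee_fin; exact: block_tr.
have sumc M : \sum_(k < M) c k <= r.+2%:R.
  rewrite -[leRHS]divr1 (le_trans _ (block_sum_inv _ r _ M ltr01))//.
  by rewrite [leRHS]big_mkcond/= ler_sum// => i _; rewrite ler1n block_gt0.
apply: (@le_lt_trans _ _ (K * (r.+2%:R * J) + b ^+ 2 * r.+2%:R)%:E); last exact: ltry.
have cVE k : (((block r k)%:R^-1)%:E * V (block r k) =
    (K * (c k * I (block r k)) + b ^+ 2 * c k)%:E)%E.
  transitivity ((c k * (K * I (block r k) + b ^+ 2))%:E); first by rewrite /V IE.
  by congr EFin; ring.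
apply: nneseries_le_bound => [k|M].
  rewrite cVE lee_fin addr_ge0// mulr_ge0// ?sqr_ge0// mulr_ge0//.
  by apply: Rintegral_ge0 => z _; rewrite sqr_ge0.
under eq_bigr do rewrite cVE.
rewrite sumEFin lee_fin big_split/= -!mulr_sumr.
by apply: lerD; apply: ler_wpM2l; [|exact: sumI|exact: sqr_ge0|exact: sumc].
Qed.

Lemma ae_mean_cen0 : {ae P, forall om, mean (X ^~ om) @ \oo --> (0 : R)}.
Proof.
apply: (orthogonal_strong_law P X _ _ _ b V) => //.
- by move=> i; exists i%:R => om; exact: cen_abs.
- move=> i j ij; apply: (data_orthogonal w q xi eta data i j (cen i) (cen j) j%:R) => //.
  by move=> z; rewrite (le_trans (cen_abs _ _))// ler_nat ltnW.
- move=> i om; rewrite /X /cen; have := tr_ge0 i (Z i om).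
  by have := le_trans (mt_m i (Z i om).2) (m_b (Z i om).2); lra.
Qed.

(** Borel-Cantelli: the events i < phi (Z i) have summable probabilities since
    the number of integers below phi z is at most phi z + 1. *)
Let ae_phi_le_eventually :
  {ae P, forall om, \forall i \near \oo, phi (Z i om) <= i%:R}.
Proof.
pose u i z : R := (i%:R < phi z)%R%:R.
have mu_ i : measurable_fun setT (u i).
  rewrite (_ : u i = fun z => if i%:R < phi z then 1 else 0).
    by apply: measurable_fun_ifT => //; exact: measurable_fun_ltr.
  by apply/funext => z; rewrite /u; case: ifP.
have sumu M z : \sum_(i < M) u i z <= phi z + 1.
  suff : \sum_(i < M) u i z <= Num.min M%:R (phi z + 1).
    by move/le_trans; apply; rewrite ge_min lexx orbT.
  elim: M => [|M ih]; first by rewrite big_ord0 le_min lexx addr_ge0.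
  rewrite big_ord_recr/= {2}/u; case: ltP => [lt|_] /=.
    move: ih; rewrite !le_min -natr1 => /andP[h1 _].
    by apply/andP; split; lra.
  by rewrite addr0 (le_trans ih)// le_min !ge_min lexx orbT ler_nat leqnSn.
have : {ae P, forall om, (fun i => u i (Z i om)) @ \oo --> (0 : R)}.
  apply: ae_cvg0_of_summable_integrals => [i|i om|].
  - by apply: measurableT_comp => //; exact: measurable_data.
  - by rewrite /u ler0n.
  apply: (@le_lt_trans _ _ (K%:E * \int[pi]_z (phi z + 1)%:E)%E).
    apply: nneseries_le_bound => [i|M].
      by apply: integral_ge0 => om _; rewrite lee_fin ler0n.
    have mEu i : measurable_fun setT (EFin \o u i) by exact/measurable_EFinP.
    apply: (@le_trans _ _ (\sum_(i < M) (K%:E * \int[pi]_z (u i z)%:E))%E).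
      apply: lee_sum => i _.
      apply: (ge0_integral_le_mscale P pi (Z i) K (EFin \o u i)) => //.
      - exact: measurable_data.
      - exact: law_le.
      - by move=> z; rewrite lee_fin ler0n.
    rewrite -ge0_sume_distrr; last first.
      by move=> i _; apply: integral_ge0 => z _; rewrite lee_fin ler0n.
    rewrite lee_wpmul2l ?lee_fin// -ge0_integral_sum//; last 2 first.
    - by move=> i; exact: mEu.
    - by move=> i z _; rewrite lee_fin ler0n.
    apply: ge0_le_integral => //.
    - by move=> z _; apply: sume_ge0 => i _; rewrite lee_fin ler0n.
    - by apply: emeasurable_sum => i; exact: mEu.
    - by apply/measurable_EFinP; exact: measurable_funD.
    - by move=> z _; rewrite sumEFin lee_fin.
  rewrite lte_mul_pinfty ?lee_fin// (integrable_lty measurableT)//.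
  apply: EFin_integrableD => //; exact: (finite_measure_integrable_cst pi 1 measurableT).
apply: filterS => om /cvgrPdist_lt/(_ 1 ltr01) [N _ NP].
exists N => // i /NP; rewrite sub0r normrN /u normr_nat.
by have [lt|//] := ltP i%:R (phi (Z i om)); rewrite /= ?mulr1n ltxx.
Qed.

Let ae_mean_eta (f : H -> R) :
  {ae P, forall om, mean (fun i => f (eta i om)) @ \oo --> \sum_h n h * f h}.
Proof.
have := ae_frequency w eta (data_stochastic data)
  (fun t h h' => data_markov data t h h') wI n n1 nS.
apply: filterS => om freq.
have E N : mean (fun i => f (eta i om)) N =
    \sum_h mean (fun i => (eta i om == h)%:R) N * f h.
  rewrite /mean; under [RHS]eq_bigr do rewrite mulrAC mulr_suml.
  rewrite -mulr_suml exchange_big/=; congr (_ / _); apply: eq_bigr => i _.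
  rewrite (bigD1 (eta i om))//= eqxx mul1r big1 ?addr0// => h /negbTE.
  by rewrite eq_sym => ->; rewrite mul0r.
rewrite (eq_cvg _ _ E); apply: cvg_big => [|h _]; first exact: add_continuous.
exact: cvgMr_tmp.
Qed.

Let sum_m : \sum_h n h * m h = \int[pi]_z phi z.
Proof.
rewrite /Rintegral (ge0_Rintegral_msum pi kap n (EFin \o phi))//.
- rewrite -sum_fine => [|h _]; last first.
    by rewrite fin_numM//; exact: (integrable_fin_num measurableT (iphik h)).
  apply: eq_bigr => h _; rewrite fineM//.
  exact: (integrable_fin_num measurableT (iphik h)).
- exact/measurable_EFinP.
Qed.

(** phi (Z i) splits into the centred truncation, the conditional mean m of phi
    in the state eta i, and an error that tends to 0. *)
Lemma ge0_data_strong_law :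
  {ae P, forall om, mean (fun i => phi (Z i om)) @ \oo --> \int[pi]_z phi z}.
Proof.
rewrite -sum_m.
have := ae_mean_eta m; have := ae_mean_cen0; have := ae_phi_le_eventually.
apply: filterS3 => om ev cen0 eta_m.
pose e i := (mt i (eta i om) - m (eta i om)) + (phi (Z i om) - tr i (Z i om)).
have e0 : e @ \oo --> (0 : R).
  have s0 : \sum_h `|mt i h - m h| @[i --> \oo] --> \sum_(h : H) (0 : R).
    apply: cvg_big => [|h _]; first exact: add_continuous.
    apply/norm_cvg0P; have := cvgB (mt_cvg h) (cvg_cst (m h)).
    by rewrite subrr; apply.
  rewrite big1// in s0.
  apply/norm_cvg0P; apply: squeeze_cvgr (@cvg_cst _ (0 : R) _ _ _) s0.
  case: ev => N _ NP; exists N => // i /NP phii.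
  have tE : tr i (Z i om) = phi (Z i om) by rewrite /tr phii.
  rewrite normr_ge0 /= /e tE subrr addr0.
  by rewrite (bigD1 (eta i om))//= lerDl sumr_ge0.
have E N : mean (fun i => phi (Z i om)) N =
    mean (X ^~ om) N + mean (fun i => m (eta i om)) N + mean e N.
  rewrite -!meanD; congr (mean _ N); apply/funext => i.
  by rewrite /X /cen /e /=; ring.
rewrite (eq_cvg _ _ E).
have := cvgD (cvgD cen0 eta_m) (mean_cesaro _ _ _ e0).
by rewrite addr0 add0r; apply.
Qed.

End nonnegative.

Theorem data_strong_law (phi : 'rV[R]_d * H -> R) : measurable_fun setT phi ->
  pi.-integrable setT (EFin \o phi) ->
  {ae P, forall om, mean (fun i => phi (Z i om)) @ \oo --> \int[pi]_z phi z}.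
Proof.
move=> mphi iphi.
have ip := integrable_funrpos measurableT iphi.
have im := integrable_funrneg measurableT iphi.
have phiE z : phi z = (phi^\+ z - phi^\- z)%R by rewrite -[in LHS](funrposBneg phi).
have := ge0_data_strong_law (phi^\-)%R (measurable_funrneg mphi) (funrneg_ge0 phi) im.
have := ge0_data_strong_law (phi^\+)%R (measurable_funrpos mphi) (funrpos_ge0 phi) ip.
apply: filterS2 => om cp cm.
have E N : mean (fun i => phi (Z i om)) N =
    mean (fun i => (phi^\+)%R (Z i om)) N - mean (fun i => (phi^\-)%R (Z i om)) N.
  rewrite /mean -mulrBl -sumrB; congr (_ / _); apply: eq_bigr => i _.
  exact: phiE.
rewrite (eq_cvg _ _ E) (_ : \int[pi]_z phi z =
  \int[pi]_z (phi^\+)%R z - \int[pi]_z (phi^\-)%R z); first exact: cvgB.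
by rewrite -RintegralB//; apply: eq_Rintegral => z _; exact: phiE.
Qed.

End law_of_large_numbers.

(** * Topology and measurability of row vectors *)

Section row_vector_topology.
Context {R : realType} {n : nat}.
Implicit Types (x y : 'rV[R]_n) (A : set 'rV[R]_n).

Lemma rV_ballP x e y : 0 < e ->
  (ball x e y <-> forall i, `|x ord0 i - y ord0 i| < e).
Proof.
move=> e0; split=> [[_ xy] i|xy]; first exact: xy.
by split => // i j; rewrite (ord1 i); exact: xy.
Qed.

Lemma measurable_rV_ball x e : measurable (ball x e).
Proof.
have [e0|e0] := ltP 0 e; last first.
  rewrite (_ : ball x e = set0)//; apply/seteqP; split => // y [e1 _].
  by move: e0; rewrite leNgt e1.
rewrite (_ : ball x e =
    \big[setI/setT]_(i < n) ((fun v : 'rV[R]_n => v ord0 i) @^-1` ball (x ord0 i) e)).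
  apply: bigsetI_measurable => i _; rewrite -[X in measurable X]setTI.
  by apply: measurable_coord => //; exact: measurable_ball.
rewrite -bigcap_seq; apply/seteqP; split => y.
  by move=> /(rV_ballP _ _ _ e0) xy i _ /=; exact: xy.
move=> xy; apply/(rV_ballP _ _ _ e0) => i.
by have := xy i; apply; rewrite /= mem_index_enum.
Qed.

Definition rat_ball (ck : 'rV[rat]_n * nat) : set 'rV[R]_n :=
  ball (map_mx ratr ck.1 : 'rV[R]_n) ck.2.+1%:R^-1.

Lemma rat_ball_basis x e : 0 < e ->
  exists2 ck, rat_ball ck x & rat_ball ck `<=` ball x e.
Proof.
move=> e0; have e20 : 0 < e / 2 by rewrite divr_gt0.
have [k ke] : exists k : nat, k.+1%:R^-1 < e / 2 :> R.
  exists (Num.trunc (e / 2)^-1); rewrite invf_plt ?posrE//.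
  exact: truncnS_gt.
have k0 : 0 < k.+1%:R^-1 :> R by rewrite invr_gt0.
have /choice[c cP] : forall i, exists r : rat, `|x ord0 i - ratr r| < k.+1%:R^-1.
  move=> i; have /rat_in_itvoo[r] : x ord0 i - k.+1%:R^-1 < x ord0 i + k.+1%:R^-1.
    by rewrite ltrBlDr -addrA ltrDl addr_gt0.
  rewrite in_itv/= => /andP[h1 h2]; exists r.
  by rewrite ltr_distlC h1.
exists (\row_i c i, k).
  apply/(rV_ballP _ _ _ k0) => i; rewrite !mxE distrC; exact: cP.
move=> y /(rV_ballP _ _ _ k0) yP; apply/(rV_ballP _ _ _ e0) => i.
have := yP i; rewrite !mxE => yi.
rewrite (le_lt_trans (ler_distD (ratr (c i)) _ _))//.
by rewrite (splitr e) ltrD// ?(lt_trans _ ke)// cP.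
Qed.

(** An open set is the union of the countably many rational balls inside it, and
    a ball of the supremum norm is a box. *)
Lemma open_measurable_rV A : open A -> measurable A.
Proof.
move=> oA.
pose F ck : set 'rV[R]_n := if `[< rat_ball ck `<=` A >] then rat_ball ck else set0.
rewrite (_ : A = \bigcup_ck F ck).
  apply: countable_bigcupT_measurable => // ck; rewrite /F; case: ifPn => // _.
  exact: measurable_rV_ball.
apply/seteqP; split => [x Ax|x [ck _]].
  have /nbhs_ballP[e /= e0 eA] := open_nbhs_nbhs (conj oA Ax).
  have [ck ckx cke] := rat_ball_basis x e e0.
  exists ck => //; rewrite /F ifT//; apply/asboolP.
  exact: subset_trans cke eA.
by rewrite /F; case: ifPn => // /asboolP; exact.
Qed.

Lemma closed_measurable_rV A : closed A -> measurable A.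
Proof.
move=> cA; rewrite -(setCK A); apply: measurableC.
by apply: open_measurable_rV; exact: closed_openC.
Qed.

Lemma within_continuous_measurable A (g : 'rV[R]_n -> R) :
  measurable A -> {within A, continuous g} -> measurable_fun A g.
Proof.
move=> mA /continuousP cg; apply: (measurability _ (RGenOpens.measurableE R)).
move=> _ [_ [a [b ->] <-]].
have /cg/open_subspaceP[V oV VE] : open `]a, b[%classic by exact: interval_open.
by rewrite setIC -VE; apply: measurableI => //; exact: open_measurable_rV.
Qed.

Lemma within_continuous_ball A (g : 'rV[R]_n -> R) x e :
  {within A, continuous g} -> A x -> 0 < e ->
  exists2 r, 0 < r & forall y, A y -> ball x r y -> `|g x - g y| < e.
Proof.
move=> /subspace_continuousP/(_ x) cg Ax e0.
have /cvgrPdist_lt/(_ e e0) := cg Ax.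
by move=> /nbhs_ballP[r /= r0 rP]; exists r => // y Ay xy; exact: rP.
Qed.

Lemma compact_seq_cluster A (a : nat -> 'rV[R]_n) : compact A ->
  (forall k, A (a k)) -> exists2 x, A x &
  forall e N, 0 < e -> exists2 k, (N <= k)%N & ball x e (a k).
Proof.
move=> cA aA.
have aA' : (a @ \oo) A by exists 0%N => // k _; exact: aA.
have [x [Ax xP]] := cA (a @ \oo) _ aA'.
exists x => // e N e0.
have h1 : (a @ \oo) (a @` [set k | (N <= k)%N]) by exists N => // k /= Nk; exists k.
have h2 : nbhs x (ball x e) by exact: nbhsx_ballx.
by have [_ [[k /= Nk <-] xk]] := xP _ _ h1 h2; exists k.
Qed.

Lemma invS_lt (e : R) : 0 < e -> exists N : nat, forall k, (N <= k)%N -> k.+1%:R^-1 < e.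
Proof.
move=> e0; exists (Num.trunc e^-1) => k Nk; rewrite invf_plt ?posrE//.
by rewrite (lt_le_trans (truncnS_gt _))// ler_nat.
Qed.

(** Heine's theorem, by contradiction: pairs of points that get closer and
    closer while their values stay apart would cluster at a point of
    discontinuity. *)
Lemma compact_uniform_continuity A (g : 'rV[R]_n -> R) e : compact A ->
  {within A, continuous g} -> 0 < e ->
  exists N : nat, forall k, (N <= k)%N -> forall x y, A x -> A y ->
    ball x k.+1%:R^-1 y -> `|g x - g y| <= e.
Proof.
move=> cA cg e0; apply: contrapT => no.
have /choice[xy xyP] : forall N : nat, exists xy : 'rV[R]_n * 'rV[R]_n,
    [/\ A xy.1, A xy.2, ball xy.1 N.+1%:R^-1 xy.2 & e < `|g xy.1 - g xy.2|].
  move=> N; apply: contrapT => no'; apply: no; exists N => k Nk x y Ax Ay bxy.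
  rewrite leNgt; apply/negP => lt; apply: no'; exists (x, y); split => //.
  by apply: le_ball bxy; rewrite lef_pV2 ?posrE// ler_nat.
have [x Ax xP] := compact_seq_cluster A (fun k => (xy k).1) cA
  (fun k => let: And4 h _ _ _ := xyP k in h).
have e20 : 0 < e / 2 by rewrite divr_gt0.
have [r r0 rP] := within_continuous_ball _ _ _ _ cg Ax e20.
have r20 : 0 < r / 2 by rewrite divr_gt0.
have [N NP] := invS_lt (r / 2) r20.
have [k Nk xk] := xP (r / 2) N r20.
have [A1 A2 b12 lt] := xyP k.
have h1 := rP _ A1 (le_ball (ltW _) xk).
have h2 : `|g x - g (xy k).2| < e / 2.
  apply: rP => //; rewrite (splitr r); apply: ball_triangle xk _.
  by apply: le_ball b12; exact/ltW/NP.
have := ler_distD (g x) (g (xy k).1) (g (xy k).2).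
rewrite (distrC _ (g x)).
have h1' : `|g x - g (xy k).1| < e / 2 by apply: h1; rewrite ltr_pdivrMr// ltr_pMr// ltr1n.
by move: lt h1' h2; lra.
Qed.

Lemma dense_sequence A a0 : A a0 ->
  exists2 t : nat -> 'rV[R]_n, (forall i, A (t i)) &
    forall x e, A x -> 0 < e -> exists i, ball x e (t i).
Proof.
move=> Aa0.
have /choice[s sP] : forall ck, exists y, A y /\
    ((exists z, A z /\ rat_ball ck z) -> rat_ball ck y).
  move=> ck; have [[z [Az ckz]]|no] := pselect (exists z, A z /\ rat_ball ck z).
    by exists z.
  by exists a0.
exists (fun i => if unpickle i is Some ck then s ck else a0).
  by move=> i; case: (unpickle i) => // ck; exact: (sP ck).1.
move=> x e Ax e0; have [ck ckx cke] := rat_ball_basis x e e0.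
exists (pickle ck); rewrite pickleK; apply: cke; apply: (sP ck).2.
by exists x.
Qed.

Lemma compact_finite_net A (t : nat -> 'rV[R]_n) e : compact A -> 0 < e ->
  (forall x e, A x -> 0 < e -> exists i, ball x e (t i)) ->
  exists N : nat, forall x, A x -> exists2 i, (i < N)%N & ball x e (t i).
Proof.
move=> cA e0 td; apply: contrapT => no.
have /choice[a aP] : forall N : nat, exists x, A x /\ forall i, (i < N)%N -> ~ ball x e (t i).
  move=> N; apply: contrapT => no'; apply: no; exists N => x Ax.
  apply: contrapT => no''; apply: no'; exists x; split => // i iN xi.
  by apply: no''; exists i.
have [x Ax xP] := compact_seq_cluster A a cA (fun k => (aP k).1).
have e20 : 0 < e / 2 by rewrite divr_gt0.
have [i xi] := td x (e / 2) Ax e20.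
have [k ik xk] := xP (e / 2) i.+1 e20.
apply: (aP k).2 ik _; rewrite (splitr e).
by apply: ball_triangle xi; exact: ball_sym.
Qed.

(** Contracting a ball around an interior point c towards x by a factor t stays
    in A by convexity, and for small t lands in any ball around x. *)
Lemma convex_interior_ball A x r : convex_set (A : set (convex_lmodType 'rV[R]_n)) ->
  A° !=set0 -> A x -> 0 < r ->
  exists c rho, [/\ 0 < rho, ball c rho `<=` A & ball c rho `<=` ball x r].
Proof.
move=> cA [c /nbhs_ballP[rho /= rho0 cA_]] Ax r0.
(* D bounds the distance from x of each point of the ball around c. *)
pose D := \sum_i `|c ord0 i - x ord0 i| + rho + 1.
have S0 : 0 <= \sum_i `|c ord0 i - x ord0 i| by exact: sumr_ge0.
have D0 : 0 < D by rewrite /D; lra.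
have Di i : `|c ord0 i - x ord0 i| + rho < D.
  rewrite /D (bigD1 i)//=; have : 0 <= \sum_(j < n | j != i) `|c ord0 j - x ord0 j|.
    exact: sumr_ge0.
  by lra.
pose t := Num.min 1 (r / D).
have t0 : 0 < t by rewrite lt_min ltr01/= divr_gt0.
have t1 : t <= 1 by rewrite ge_min lexx.
have tD : t * D <= r by rewrite -ler_pdivlMr// ge_min lexx orbT.
have trho : 0 < t * rho by rewrite mulr_gt0.
exists (t *: c + (1 - t) *: x), (t * rho); split => //.
- move=> y /(rV_ballP _ _ _ trho) yP.
  pose u := t^-1 *: (y - (1 - t) *: x).
  have Au : A u.
    apply: cA_; apply/(rV_ballP _ _ _ rho0) => i.
    rewrite -(ltr_pM2l t0); apply: le_lt_trans (yP i).
    rewrite -[X in X * _](gtr0_norm t0) -normrM !mxE.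
    rewrite le_eqVlt; apply/orP; left; apply/eqP; congr `|_|.
    by field; rewrite gt_eqF.
  have := cA u x (Itv01 (ltW t0) t1) (mem_set Au) (mem_set Ax).
  rewrite inE; congr A; apply/rowP => i.
  rewrite /conv/= /u !mxE mulVKf ?subrK// gt_eqF//.
- move=> y /(rV_ballP _ _ _ trho) yP; apply/(rV_ballP _ _ _ r0) => i.
  have := yP i; rewrite !mxE => yi.
  apply: lt_le_trans tD.
  have Dti : `|t * (c ord0 i - x ord0 i)| + t * rho < t * D.
    by rewrite normrM (gtr0_norm t0) -mulrDr ltr_pM2l.
  apply: le_lt_trans Dti.
  have -> : x ord0 i - y ord0 i =
      (t * c ord0 i + (1 - t) * x ord0 i - y ord0 i) - t * (c ord0 i - x ord0 i).
    by ring.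
  rewrite (le_trans (ler_normB _ _))// addrC lerD2l.
  exact: ltW.
Qed.

End row_vector_topology.

(** * A uniform law of large numbers *)

Section uniform_law_of_large_numbers.
Context {d} {S : measurableType d} {R : realType} {s : nat}.
Variables (pi : probability S R) (Theta : set 'rV[R]_s) (L : 'rV[R]_s -> S -> R)
  (g : S -> R) (Good : set S).
Hypothesis Theta_compact : compact Theta.
Hypothesis mL : forall theta, Theta theta -> measurable_fun setT (L theta).
Hypothesis cL : forall z, Good z -> {within Theta, continuous (L ^~ z)}.
Hypothesis aeGood : {ae pi, forall z, Good z}.
Hypothesis ig : pi.-integrable setT (EFin \o g).
Hypothesis Lg : forall theta, Theta theta -> {ae pi, forall z, `|L theta z| <= g z}.

Lemma family_integrable theta : Theta theta -> pi.-integrable setT (EFin \o L theta).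
Proof.
move=> Tt; apply/integrableP; split; first exact/measurable_EFinP/mL.
apply: le_lt_trans (integrable_lty measurableT (integrable_norm ig)).
apply: ae_ge0_le_integral => //.
- by apply/measurableT_comp => //; exact/measurable_EFinP/mL.
- by move=> z _ /=; rewrite lee_fin.
- exact: measurable_int (integrable_norm ig).
apply: filterS (Lg theta Tt) => z Lz _ /=.
by rewrite lee_fin (le_trans Lz)// ler_norm.
Qed.

(** Suprema over a dense sequence of parameters are measurable. *)
Variable t : nat -> 'rV[R]_s.
Hypothesis tT : forall i, Theta (t i).
Hypothesis t_dense : forall x e, Theta x -> 0 < e -> exists i, ball x e (t i).

(** The index k codes a pair (i, j); it contributes only when t i and t j are
    within 1 / (n + 1) of each other. *)
Let gap (n k : nat) z : R :=
  if unpickle k is Some (i, j) then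
    if `[< ball (t i) n.+1%:R^-1 (t j) >] then `|L (t i) z - L (t j) z| else 0
  else 0.

Let m_gap n k : measurable_fun setT (gap n k).
Proof.
rewrite /gap; case: (unpickle k) => [[i j]|]; last exact: measurable_cst.
case: `[< _ >] => //; apply: measurableT_comp => //.
by apply: measurable_funB; exact: mL.
Qed.

Let gap_ge0 n k z : 0 <= gap n k z.
Proof. by rewrite /gap; case: (unpickle k) => [[i j]|]//; case: ifPn. Qed.

Definition oscillation n z : R := fine (ereal_sup (range (fun k => (gap n k z)%:E))).

Lemma measurable_oscillation n : measurable_fun setT (oscillation n).
Proof.
apply: (@measurableT_comp _ _ _ _ _ _ fine); first exact: fine_measurable.
rewrite (_ : (fun z => _) = fun z => esups (fun k => (gap n k z)%:E) 0%N).
  by apply: measurable_fun_esups => k; exact/measurable_EFinP.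
apply/funext => z; congr ereal_sup.
by apply/seteqP; split => x [k _ <-]; exists k.
Qed.

Let gap_sup_le n z c : (forall k, gap n k z <= c) ->
  0 <= oscillation n z <= c /\ forall k, gap n k z <= oscillation n z.
Proof.
move=> gc; rewrite /oscillation; set E := ereal_sup _.
have Ec : (E <= c%:E)%E by apply: ge_ereal_sup => _ [k _ <-]; rewrite lee_fin.
have kE k : ((gap n k z)%:E <= E)%E by apply: ereal_sup_ubound; exists k.
have E0 : (0 <= E)%E by apply: le_trans (kE 0%N); rewrite lee_fin.
have fE : E \is a fin_num.
  by rewrite ge0_fin_numE// (le_lt_trans Ec)// ltry.
split; last by move=> k; rewrite -lee_fin fineK.
by rewrite fine_ge0//= -lee_fin fineK.
Qed.

Let gap_bounded z : Good z -> exists c, forall n k, gap n k z <= c.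
Proof.
move=> Gz.
have [|c1 _ c1P] := compact_EVT_max _ Theta_compact (cL z Gz); first by exists (t 0%N).
have [|c2 _ c2P] := compact_EVT_min _ Theta_compact (cL z Gz); first by exists (t 0%N).
exists (L c1 z - L c2 z) => n k; rewrite /gap.
have c0 : 0 <= L c1 z - L c2 z.
  by rewrite subr_ge0; apply: le_trans (c1P _ (mem_set (tT 0%N))); exact: c2P (mem_set _).
case: (unpickle k) => [[i j]|]//; case: ifPn => // _.
rewrite ler_norml.
have := c1P _ (mem_set (tT i)); have := c2P _ (mem_set (tT i)).
have := c1P _ (mem_set (tT j)); have := c2P _ (mem_set (tT j)).
by lra.
Qed.

Lemma oscillation_ge0 n z : 0 <= oscillation n z.
Proof.
by apply/fine_ge0/(@le_trans _ _ (gap n 0 z)%:E);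
  [rewrite lee_fin|apply: ereal_sup_ubound; exists 0%N].
Qed.

(** Approximating x and y by points of the dense sequence costs some distance,
    whence the radius 1 / (2 (n + 1)) instead of 1 / (n + 1). *)
Lemma oscillation_modulus n z x y : Good z -> Theta x -> Theta y ->
  ball x (n.+1%:R^-1 / 2) y -> `|L x z - L y z| <= oscillation n z.
Proof.
move=> Gz Tx Ty xy; have [c cP] := gap_bounded z Gz.
have [_ gapo] := gap_sup_le n z c (cP n).
apply/ler_addgt0Pr => e e0.
have e20 : 0 < e / 2 by rewrite divr_gt0.
have [r1 r10 r1P] := within_continuous_ball _ _ _ _ (cL z Gz) Tx e20.
have [r2 r20 r2P] := within_continuous_ball _ _ _ _ (cL z Gz) Ty e20.
(* q + 1 / (2 (n + 1)) + q = 1 / (n + 1) *)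
pose q : R := n.+1%:R^-1 / 2 / 2.
have q0 : 0 < q by rewrite !divr_gt0// invr_gt0.
have [i xi] := t_dense x (Num.min r1 q) Tx (ltac:(by rewrite lt_min r10)).
have [j yj] := t_dense y (Num.min r2 q) Ty (ltac:(by rewrite lt_min r20)).
have bij : ball (t i) n.+1%:R^-1 (t j).
  rewrite (splitr n.+1%:R^-1).
  have -> : n.+1%:R^-1 / 2 = q + q by rewrite /q -splitr.
  rewrite addrA; apply: (@ball_triangle _ _ y).
    rewrite addrAC -splitr addrC; apply: (@ball_triangle _ _ x).
      by apply: ball_sym; apply: le_ball xi; rewrite ge_min lexx orbT.
    exact: xy.
  by apply: le_ball yj; rewrite ge_min lexx orbT.
have := gapo (pickle (i, j)); rewrite /gap pickleK ifT; last exact/asboolP.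
have : `|L x z - L (t i) z| < e / 2.
  by apply: r1P => //; apply: le_ball xi; rewrite ge_min lexx.
have : `|L y z - L (t j) z| < e / 2.
  by apply: r2P => //; apply: le_ball yj; rewrite ge_min lexx.
rewrite (distrC (L y z)) => h1 h2 h3.
have := ler_distD (L (t i) z) (L x z) (L y z).
have := ler_distD (L (t j) z) (L (t i) z) (L y z).
by lra.
Qed.

Lemma oscillation_cvg0 z : Good z -> oscillation ^~ z @ \oo --> (0 : R).
Proof.
move=> Gz; apply/cvgrPdist_le => e e0.
have [N NP] := compact_uniform_continuity _ _ _ Theta_compact (cL z Gz) e0.
exists N => // k Nk /=; rewrite sub0r normrN ger0_norm ?oscillation_ge0//.
have [|/andP[]//] := gap_sup_le k z e.
move=> l; rewrite /gap; case: (unpickle l) => [[i j]|]; last exact: ltW.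
by case: ifPn => [/asboolP b|_]; [apply: (NP k Nk) => //|exact: ltW].
Qed.

Let ae_oscillation_le : {ae pi, forall z, forall n, oscillation n z <= 2 * `|g z|}.
Proof.
have : {ae pi, forall z, forall i, `|L (t i) z| <= g z}.
  by apply/ae_foralln => i; exact: Lg.
apply: filterS => z Lz n.
have [|/andP[]//] := gap_sup_le n z (2 * `|g z|).
have gg := ler_norm (g z).
move=> l; rewrite /gap; case: (unpickle l) => [[i j]|]; last by rewrite mulr_ge0.
case: ifPn => [_|_]; last by rewrite mulr_ge0.
rewrite (le_trans (ler_normB _ _))//.
by have := Lz i; have := Lz j; lra.
Qed.

Let i2g : pi.-integrable setT (EFin \o (fun z => 2 * `|g z|)).
Proof.
have := integrableZl measurableT 2 (integrable_norm ig).
by apply: eq_integrable => // z _ /=; rewrite EFinM.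
Qed.

Lemma oscillation_integrable n : pi.-integrable setT (EFin \o oscillation n).
Proof.
apply/integrableP; split; first exact/measurable_EFinP/measurable_oscillation.
apply: le_lt_trans (integrable_lty measurableT i2g).
apply: ae_ge0_le_integral => //.
- by apply/measurableT_comp => //; exact/measurable_EFinP/measurable_oscillation.
- by move=> z _; rewrite lee_fin mulr_ge0.
- exact: measurable_int i2g.
apply: filterS ae_oscillation_le => z oz _ /=.
by rewrite lee_fin ger0_norm ?oscillation_ge0.
Qed.

(** Dominated convergence, with bound 2 |g|. *)
Lemma oscillation_mean_cvg0 : (\int[pi]_z oscillation n z) @[n --> \oo] --> (0 : R).
Proof.
have aeo : {ae pi, forall z, [set: S] z ->
    (fun n => (EFin \o oscillation n) z) @ \oo --> 0%E}.
  apply: filterS aeGood => z Gz _; apply: cvg_EFin; first exact: nearW.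
  exact: oscillation_cvg0.
have aeg : {ae pi, forall z n, [set: S] z ->
    (`|(EFin \o oscillation n) z| <= (2 * `|g z|)%:E)%E}.
  apply: filterS ae_oscillation_le => z oz n _ /=.
  by rewrite lee_fin ger0_norm ?oscillation_ge0.
have [_ _] := @dominated_convergence _ _ _ pi setT measurableT
  (fun n => EFin \o oscillation n) (cst 0%E) (EFin \o (fun z => 2 * `|g z|))
  (fun n => measurable_int _ (oscillation_integrable n)) (measurable_cst _)
  aeo i2g aeg.
by rewrite integral0 => /fine_cvg.
Qed.

Definition mean_value theta := \int[pi]_z L theta z.

Lemma mean_value_modulus n x y : Theta x -> Theta y ->
  ball x (n.+1%:R^-1 / 2) y ->
  `|mean_value x - mean_value y| <= \int[pi]_z oscillation n z.
Proof.
move=> Tx Ty xy; have ix := family_integrable x Tx; have iy := family_integrable y Ty.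
have ixy := EFin_integrableB pi setT _ _ measurableT ix iy.
rewrite /mean_value -RintegralB//.
apply: (le_trans (le_normr_Rintegral measurableT ixy)).
rewrite -lee_fin /Rintegral !fineK.
- apply: ae_ge0_le_integral => //.
  + exact: measurable_int (integrable_norm ixy).
  + by move=> z _; rewrite lee_fin oscillation_ge0.
  + exact/measurable_EFinP/measurable_oscillation.
  + apply: filterS aeGood => z Gz _; rewrite lee_fin; exact: oscillation_modulus.
- exact: (integrable_fin_num measurableT (oscillation_integrable n)).
- exact: (integrable_fin_num measurableT (integrable_norm ixy)).
Qed.

Lemma mean_value_continuous : {within Theta, continuous mean_value}.
Proof.
apply/subspace_continuousP => x Tx; apply/cvgrPdist_le => e e0.
have /cvgrPdist_le/(_ e e0)[N _ NP] := oscillation_mean_cvg0.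
have r0 : 0 < N.+1%:R^-1 / 2 :> R by rewrite divr_gt0// invr_gt0.
apply/nbhs_ballP; exists (N.+1%:R^-1 / 2) => //= y xy Ty.
rewrite (le_trans (mean_value_modulus N x y Tx Ty xy))//.
have := NP N (leqnn N); rewrite sub0r normrN.
exact/le_trans/ler_norm.
Qed.

(** A point theta is compared with a point t i of a finite net: both the average
    and the mean of L change by no more than the average and the mean of the
    oscillation, which are small, and on the net the convergence is uniform.
    The sequence z is deterministic: it is one realization of the data. *)
Lemma uniform_strong_law (z : nat -> S) : (forall i, Good (z i)) ->
  (forall i, mean (L (t i) \o z) @ \oo --> mean_value (t i)) ->
  (forall n, mean (oscillation n \o z) @ \oo --> \int[pi]_z oscillation n z) ->
  forall e, 0 < e -> \forall N \near \oo, forall theta, Theta theta ->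
    `|mean (L theta \o z) N - mean_value theta| <= e.
Proof.
move=> Gz Lcvg ocvg e e0; have e40 : 0 < e / 4 by rewrite divr_gt0.
have /cvgrPdist_le/(_ _ e40)[n _ /(_ n (leqnn n))] := oscillation_mean_cvg0.
rewrite sub0r normrN => nP; have {}nP := le_trans (ler_norm _) nP.
have r0 : 0 < n.+1%:R^-1 / 2 :> R by rewrite divr_gt0// invr_gt0.
have [M MP] := compact_finite_net _ t _ Theta_compact r0 t_dense.
have /cvgrPdist_le/(_ _ e40) := ocvg n.
have : \forall N \near \oo, forall i : 'I_M,
    `|mean_value (t i) - mean (L (t i) \o z) N| <= e / 4.
  by apply: filter_forall => i; have /cvgrPdist_le/(_ _ e40) := Lcvg i.
apply: filterS2 => N LN oN theta Tt.
have [i iM ti] := MP theta Tt.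
have := LN (Ordinal iM) => /= Li.
have Lo : `|mean (L theta \o z) N - mean (L (t i) \o z) N| <= mean (oscillation n \o z) N.
  rewrite /mean -mulrBl -sumrB normrM normfV (@ger0_norm _ N%:R)//.
  rewrite ler_wpM2r ?invr_ge0// (le_trans (ler_norm_sum _ _ _))// ler_sum// => j _.
  exact: oscillation_modulus.
have mo := mean_value_modulus n theta (t i) Tt (tT i) ti.
rewrite distrC in Li; rewrite distrC in mo.
have := ler_norm (mean (oscillation n \o z) N - \int[pi]_z oscillation n z).
rewrite distrC in oN.
have := ler_distD (mean (L (t i) \o z) N) (mean (L theta \o z) N) (mean_value theta).
have := ler_distD (mean_value (t i)) (mean (L (t i) \o z) N) (mean_value theta).
move: nP oN Li Lo mo.
set a1 := `|_ - _|; set a2 := `|_ - _|; set a3 := `|_ - _|.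
by lra.
Qed.

End uniform_law_of_large_numbers.

(** * Concentration of the posterior *)

Lemma lebesgue_rV_ball (R : realType) n (c : 'rV[R]_n) (r : R) : 0 < r ->
  lebesgue_rV (ball c r) = ((r *+ 2) ^+ n)%:E.
Proof.
move=> r0; have -> : ball c r = [set v | forall i, ball (c ord0 i) r (v ord0 i)].
  by apply/seteqP; split => v /(rV_ballP _ _ _ r0).
rewrite (@lebesgue_rV_box R n (fun i => ball (c ord0 i : R) r)); last first.
  by move=> i; exact: measurable_ball.
under eq_bigr do rewrite lebesgue_measure_ball ?ltW//.
by rewrite prodEFin prodr_const card_ord.
Qed.

Section posterior_concentration.
Context {R : realType} {dH : measure_display} {H : finMeasurableType dH} {d s : nat}.
Variables (Theta : set 'rV[R]_s) (f : 'rV[R]_d -> H -> 'rV[R]_s -> R)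
  (p : density Theta) (w : H -> H -> R) (x : nat -> 'rV[R]_d) (e : nat -> H).
Variables (c2 delta m : R) (lam : 'rV[R]_s -> R) (c : 'rV[R]_s) (rho : R)
  (K : set 'rV[R]_s).
Hypothesis mTheta : measurable Theta.
Hypothesis w_ge0 : forall h k, 0 <= w h k.
Hypothesis f_gt0 : forall i theta, Theta theta -> 0 < f (x i) (e i) theta.
Hypothesis mlnf : forall i, measurable_fun Theta (fun theta => ln (f (x i) (e i) theta)).
Hypothesis c2_gt0 : 0 < c2.
Hypothesis p_ge : forall theta, Theta theta -> c2 <= p theta.
Hypothesis delta_gt0 : 0 < delta.
Hypothesis lam_le : forall theta, Theta theta -> lam theta <= m.
Hypothesis rho_gt0 : 0 < rho.
Hypothesis VTheta : ball c rho `<=` Theta.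
Hypothesis lam_V : forall theta, ball c rho theta -> m - delta / 4 <= lam theta.
Hypothesis mK : measurable K.
Hypothesis KTheta : K `<=` Theta.
Hypothesis lam_K : forall theta, K theta -> lam theta <= m - delta.

Let l N theta := mean (fun i => ln (f (x i) (e i) theta)) N.
Hypothesis l_unif : \forall N \near \oo, forall theta, Theta theta ->
  `|l N theta - lam theta| <= delta / 4.

Let a N := \prod_(1 <= i < N) w (e i.-1) (e i).

Let likE N theta : Theta theta ->
  likelihood f w x e N.+1 theta = a N.+1 * expR (N.+1%:R * l N.+1 theta).
Proof.
move=> Tt; rewrite /likelihood big_split/= -/(a _) mulrA mulrC; congr (_ * _).
have <- : \prod_(0 <= i < N.+1) f (x i) (e i) theta =
    f (x 0%N) (e 0%N) theta * \prod_(1 <= i < N.+1) f (x i) (e i) theta.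
  by rewrite big_ltn.
rewrite big_mkord.
rewrite /l /mean mulrCA divff ?pnatr_eq0// mulr1 expR_sum.
by apply: eq_bigr => i _; rewrite lnK// posrE f_gt0.
Qed.

Let a_ge0 N : 0 <= a N.
Proof. by apply: prodr_ge0 => i _. Qed.

Let p_ge0 theta : 0 <= p theta.
Proof. exact: density_ge0 (densityP p) theta. Qed.

Let mp : measurable_fun setT p.
Proof. exact: density_measurable (densityP p). Qed.

Let m_l N : measurable_fun Theta (l N).
Proof. by apply: measurable_funM => //; exact: measurable_sum. Qed.

Let int_p A : measurable A -> (\int[@lebesgue_rV R s]_(theta in A) (p theta)%:E <= 1)%E.
Proof.
move=> mA; rewrite -(density_mass (densityP p)); apply: ge0_subset_integral => //.
- by apply/measurable_EFinP.
- by move=> y _; rewrite lee_fin.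
Qed.

Let v := (rho *+ 2) ^+ s.
Let v_gt0 : 0 < v. Proof. by rewrite exprn_gt0// pmulrn_lgt0. Qed.

(** If some transition along the path has probability 0, the posterior density
    vanishes on Theta.  Otherwise the numerator is at most a exp (n (m - 3 delta / 4)) and the
    normalizing constant is at least a exp (n (m - delta / 2)) c2 v, the
    contribution of the ball of volume v; finally exp (- y) <= 1 / y with
    y = n delta / 4. *)
Lemma posterior_le N :
  (forall theta, Theta theta -> `|l N.+1 theta - lam theta| <= delta / 4) ->
  (posterior Theta f p w x e N.+1 K <= (4 / (delta * c2 * v) / N.+1%:R)%:E)%E.
Proof.
move=> lu; set B := 4 / _ / _.
have B0 : 0 <= B by rewrite !divr_ge0// mulr_ge0 ?ltW// mulr_gt0.
rewrite /posterior /posterior_density.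
have [a0|a0] := eqVneq (a N.+1) 0.
  rewrite integral0_eq// => theta Kt.
  by rewrite likE; [rewrite a0 !mul0r|exact: KTheta].
have {}a0 : 0 < a N.+1 by rewrite lt_neqAle eq_sym a0/=.
pose n : R := N.+1%:R.
have n0 : 0 < n by [].
have nz : 0 <= n by rewrite ltW.
have ml : measurable_fun Theta (fun theta => a N.+1 * expR (n * l N.+1 theta) * p theta).
  apply: measurable_funM; last exact: measurable_funTS.
  apply: measurable_funM => //; apply: measurableT_comp => //.
  exact: measurable_funM.
set Z := \int[_]_(_ in _) _.
have ZE : Z = \int[@lebesgue_rV R s]_(theta in Theta)
    (a N.+1 * expR (n * l N.+1 theta) * p theta).
  by apply: eq_Rintegral => theta; rewrite inE => /likE ->.
have g0 theta : 0 <= a N.+1 * expR (n * l N.+1 theta) * p theta.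
  by rewrite !mulr_ge0// expR_ge0.
have mE A : measurable A -> A `<=` Theta -> measurable_fun A
    (fun theta => (a N.+1 * expR (n * l N.+1 theta) * p theta)%:E).
  by move=> mA AT; apply/measurable_EFinP; apply: measurable_funS ml.
have int_up A C : measurable A -> A `<=` Theta ->
    (forall theta, A theta -> l N.+1 theta <= C) ->
    (\int[@lebesgue_rV R s]_(theta in A) (a N.+1 * expR (n * l N.+1 theta) * p theta)%:E
     <= (a N.+1 * expR (n * C))%:E)%E.
  move=> mA AT lC.
  apply: (@le_trans _ _ (\int[@lebesgue_rV R s]_(theta in A)
      ((a N.+1 * expR (n * C))%:E * (p theta)%:E))%E).
    apply: ge0_le_integral => //.
    - by move=> y _; rewrite lee_fin.
    - exact: mE.
    - by apply: measurable_funeM; apply/measurable_EFinP; exact: measurable_funTS.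
    - move=> y Ay; rewrite -EFinM lee_fin ler_wpM2r// ler_wpM2l//.
      by rewrite ler_expR ler_wpM2l// lC.
  rewrite ge0_integralZl//.
  - by rewrite -[leRHS]mule1 lee_wpmul2l ?int_p// lee_fin mulr_ge0// expR_ge0.
  - by apply/measurable_EFinP; exact: measurable_funTS.
  - by move=> y _; rewrite lee_fin.
  - by rewrite lee_fin mulr_ge0// expR_ge0.
pose J := (\int[@lebesgue_rV R s]_(theta in Theta)
  (a N.+1 * expR (n * l N.+1 theta) * p theta)%:E)%E.
(* The normalizing constant is a real integral, which agrees with the extended
   one because the log-likelihood averages are bounded above on Theta. *)
have JE : J = Z%:E.
  rewrite ZE /Rintegral fineK// ge0_fin_numE; last first.
    by apply: integral_ge0 => y _; rewrite lee_fin.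
  rewrite (le_lt_trans (int_up Theta (m + delta / 4) mTheta _ _)) ?ltry//.
  move=> y Ty; have := lu y Ty; have := lam_le y Ty.
  by rewrite ler_norml => ? /andP[]; lra.
pose C3 := a N.+1 * expR (n * (m - delta / 2)) * c2.
have C30 : 0 < C3 by rewrite !mulr_gt0// expR_gt0.
have Zlow : C3 * v <= Z.
  rewrite -lee_fin -JE /v EFinM -(lebesgue_rV_ball _ _ c rho rho_gt0).
  have mV : measurable (ball c rho) by exact: measurable_rV_ball.
  rewrite -integral_cst//.
  apply: (@le_trans _ _ (\int[@lebesgue_rV R s]_(theta in ball c rho)
      (a N.+1 * expR (n * l N.+1 theta) * p theta)%:E)%E).
    apply: ge0_le_integral => //.
    - by move=> y _; rewrite lee_fin ltW.
    - exact: mE.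
    - move=> y Vy; have Ty := VTheta y Vy.
      rewrite lee_fin /C3 ler_pM ?p_ge// ?mulr_ge0 ?expR_ge0 ?(ltW c2_gt0)//.
      rewrite ler_wpM2l// ler_expR ler_wpM2l//.
      have := lu y Ty; have := lam_V y Vy.
      by rewrite ler_norml => ? /andP[]; lra.
  apply: ge0_subset_integral => //; first exact: mE.
  by move=> y _; rewrite lee_fin.
clearbody Z.
have Z0 : 0 < Z by rewrite (lt_le_trans _ Zlow)// mulr_gt0.
rewrite (eq_integral (fun theta => (Z^-1)%:E *
    (a N.+1 * expR (n * l N.+1 theta) * p theta)%:E)%E); last first.
  move=> y; rewrite inE => Ky; rewrite (likE _ _ (KTheta y Ky)).
  by rewrite -EFinM; congr EFin; exact: mulrC.
rewrite ge0_integralZl//; first last.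
- by rewrite lee_fin invr_ge0 ltW.
- by move=> y _; rewrite lee_fin.
- exact: mE.
have h1 : (\int[@lebesgue_rV R s]_(theta in K)
    (a N.+1 * expR (n * l N.+1 theta) * p theta)%:E
     <= (a N.+1 * expR (n * (m - 3 * delta / 4)))%:E)%E.
  apply: int_up => // y Ky.
  have := lu y (KTheta y Ky); have := lam_K y Ky.
  by rewrite ler_norml => ? /andP[]; lra.
have Zi : (0 <= (Z^-1)%:E)%E by rewrite lee_fin invr_ge0 ltW.
apply: (le_trans (lee_wpmul2l Zi h1)).
rewrite -EFinM lee_fin mulrC ler_pdivrMr//.
apply: le_trans (ler_wpM2l B0 Zlow).
pose y := n * delta / 4.
have y0 : 0 < y by rewrite divr_gt0// mulr_gt0.
have -> : B * (C3 * v) = a N.+1 * (expR (n * (m - delta / 2)) / y).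
  by rewrite /B /C3 /y; field; rewrite !gt_eqF.
rewrite ler_wpM2l//.
have -> : n * (m - 3 * delta / 4) = n * (m - delta / 2) - y by rewrite /y; field.
rewrite expRD ler_wpM2l ?expR_ge0// expRN lef_pV2 ?posrE ?expR_gt0//.
by rewrite (le_trans _ (expR_ge1Dx _))// lerDr.
Qed.

Lemma posterior_cvg0 : posterior Theta f p w x e N K @[N --> \oo] --> 0%E.
Proof.
rewrite -(cvg_shiftS (fun N => posterior Theta f p w x e N K)).
have B0 : (fun N => (4 / (delta * c2 * v) / N.+1%:R)%:E : \bar R) @ \oo --> 0%E.
  apply: cvg_EFin; first exact: nearW.
  rewrite -(mulr0 (4 / (delta * c2 * v))); apply: cvgMl_tmp.
  exact: cvg_harmonic.
apply: (squeeze_cvge _ (@cvg_cst _ 0%E _ _ _) B0).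
case: l_unif => M _ MP; exists M => // N MN.
apply/andP; split; last by apply: posterior_le => theta; exact: MP N.+1 (leqW MN) theta.
apply: integral_ge0 => theta Kt; rewrite lee_fin /posterior_density.
have l_ge0 y : Theta y -> 0 <= likelihood f w x e N.+1 y * p y.
  by move=> Ty; rewrite likE// !mulr_ge0// expR_ge0.
by apply: divr_ge0; [apply: l_ge0; exact: KTheta|exact: Rintegral_ge0].
Qed.

End posterior_concentration.

(** * The theorem *)

Section distance_to_maximizers.
Context {R : realType} {s : nat}.
Implicit Types (T : set 'rV[R]_s) (eps : R).

Lemma enorm0 : enorm (0 : 'rV[R]_s) = 0.
Proof. by rewrite /enorm big1 ?sqrtr0// => i _; rewrite mxE expr0n. Qed.

Lemma enorm_continuous (y : 'rV[R]_s) : continuous (fun x : 'rV[R]_s => enorm (x - y)).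
Proof.
have E : (fun x : 'rV[R]_s => enorm (x - y)) =1
    (fun x : 'rV[R]_s => Num.sqrt (\sum_i (x ord0 i - y ord0 i) ^+ 2)).
  by move=> x; congr Num.sqrt; apply: eq_bigr => i _; rewrite !mxE.
rewrite (funext E) => x.
apply: (@continuous_comp _ _ _
  (fun x : 'rV[R]_s => \sum_i (x ord0 i - y ord0 i) ^+ 2) Num.sqrt);
  last exact: sqrt_continuous.
apply: cvg_big; [exact: add_continuous|exact: (nbhs_filter x)|move=> i _].
apply: (@continuous_comp _ _ _
  (fun x : 'rV[R]_s => x ord0 i - y ord0 i) (fun a => a ^+ 2));
  last exact: exprn_continuous.
have cx := @coord_continuous R 1 s ord0 i x.
exact: (cvgB cx (cvg_cst (y ord0 i))).
Qed.

(** A closed substitute for the set of points at distance at least eps from T,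
    described without the infimum. *)
Definition away T eps := [set x : 'rV[R]_s | forall y, T y -> eps <= enorm (x - y)].

Lemma closed_away T eps : closed (away T eps).
Proof.
rewrite (_ : away T eps =
    \bigcap_(y in T) ((fun x : 'rV[R]_s => enorm (x - y)) @^-1` [set a | eps <= a])).
  apply: closed_bigI => y _; apply: (preimage_closed _ (@closed_ge _ eps)) => x _.
  exact: enorm_continuous.
by apply/seteqP; split => x.
Qed.

Lemma dist_away T eps x : (eps%:E < dist x T)%E -> away T eps x.
Proof.
move=> h y Ty; rewrite -lee_fin (le_trans (ltW h))//.
by apply: ereal_inf_lbound; exists y.
Qed.

(** A strict lower bound on an infimum leaves room for some 1 / (k + 1). *)
Lemma dist_gtE T eps :
  [set x | (eps%:E < dist x T)%E] = \bigcup_k away T (eps + k.+1%:R^-1).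
Proof.
apply/seteqP; split => [x /= h|x [k _ xk]].
  have [k hk] : exists k, ((eps + k.+1%:R^-1)%:E <= dist x T)%E.
    case: (dist x T) h => [r| |]//; last by exists 0%N; rewrite leey.
    rewrite lte_fin -subr_gt0 => /invS_lt[k /(_ k (leqnn k)) kr].
    by exists k; rewrite lee_fin -lerBrDl ltW.
  exists k => // y Ty; rewrite -lee_fin (le_trans hk)//.
  by apply: ereal_inf_lbound; exists y.
rewrite /=; apply: (@lt_le_trans _ _ (eps + k.+1%:R^-1)%:E).
  by rewrite lte_fin ltrDl invr_gt0.
by apply: le_ereal_inf_tmp => _ [y Ty <-]; rewrite lee_fin; exact: xk.
Qed.

Lemma measurable_dist_gt T eps : measurable [set x : 'rV[R]_s | (eps%:E < dist x T)%E].
Proof.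
rewrite dist_gtE; apply: bigcupT_measurable => k.
by apply: closed_measurable_rV; exact: closed_away.
Qed.

Lemma dist_set1 (x y : 'rV[R]_s) : dist x [set y] = (enorm (x - y) : R)%:E.
Proof. by rewrite /dist image_set1 ereal_inf1. Qed.

(** The points of A away from T form a compact set; lam attains its maximum over
    it at a point outside T, hence below m. *)
Lemma max_gap (A T : set 'rV[R]_s) (lam : 'rV[R]_s -> R) m eps :
  compact A -> {within A, continuous lam} -> 0 < eps ->
  (forall x, A x -> lam x <= m) -> (forall x, A x -> lam x = m -> T x) ->
  exists2 delta, 0 < delta & forall x, A x -> away T eps x -> lam x <= m - delta.
Proof.
move=> cA cl eps0 lm lT.
have cK : compact (A `&` away T eps) by apply: compact_closedI => //; exact: closed_away.
have [K0|K0] := pselect ((A `&` away T eps) !=set0); last first.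
  by exists 1 => // x Ax xa; exfalso; apply: K0; exists x.
have cKl : {within A `&` away T eps, continuous lam}.
  by apply: continuous_subspaceW cl => x [].
have [c /set_mem[Ac ca] cP] := compact_EVT_max K0 cK cKl.
exists (m - lam c).
  rewrite subr_gt0 lt_neqAle lm// andbT; apply/eqP => lcm.
  have := ca c (lT c Ac lcm).
  by rewrite subrr enorm0 leNgt eps0.
by move=> x Ax xa; rewrite opprB addrC subrK cP//; exact: mem_set.
Qed.

End distance_to_maximizers.

Theorem theorem3p1 (R : realType) (dO dH : measure_display)
    (Omega : measurableType dO) (P : probability Omega R)
    (H : finMeasurableType dH) (d s : nat)
    (Xi : set 'rV[R]_d) (Theta : set 'rV[R]_s)
    (w : H -> H -> R) (q : H -> density Xi)
    (xi : {RV P >-> 'rV[R]_d}^nat) (eta : {RV P >-> H}^nat)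
    (f : 'rV[R]_d -> H -> 'rV[R]_s -> R) (p : density Theta)
    (nu : probability H R) (c1 c2 : R)
    (Xi_closed : closed Xi)
    (data : data_process w q xi eta)
    (f_density : forall h theta, Theta theta ->
      is_density Xi (fun x => f x h theta))
    (nu_stationary : stationary w nu)
    (Theta_convex : convex_set (Theta : set (convex_lmodType 'rV[R]_s)))
    (Theta_compact : compact Theta)
    (Theta_interior : Theta° !=set0)
    (c2_gt0 : 0 < c2) (c1_ge_c2 : c2 <= c1)
    (p_bounds : forall theta, Theta theta -> c2 <= p theta <= c1)
    (f_gt0 : forall x h theta, Xi x -> Theta theta -> 0 < f x h theta)
    (f_continuous : forall x h, Xi x -> {within Theta, continuous (f x h)})
    (w_irreducible : irreducible w) (w_aperiodic : aperiodic w)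
    (f_dominated : exists g : 'rV[R]_d * H -> R,
      (stationary_law nu q).-integrable setT (EFin \o g) /\
      forall theta, Theta theta ->
        {ae stationary_law nu q, forall z, `|ln (f z.1 z.2 theta)| <= g z}) :
  let post om := posterior Theta f p w (xi ^~ om) (eta ^~ om) in
  let Tstar := Theta_star Theta nu q f in
  {ae P, forall om, forall eps : R, 0 < eps ->
    post om N [set theta | Theta theta /\ (eps%:E < dist theta Tstar)%E]
      @[N --> \oo] --> 0%E} /\
  forall theta_star, Tstar = [set theta_star] ->
    {ae P, forall om, forall eps : R, 0 < eps ->
      post om N [set theta | Theta theta /\ eps < enorm (theta - theta_star)]
        @[N --> \oo] --> 0%E}.
Proof.
pose pi : probability _ R := stationary_law nu q.
pose L theta (z : 'rV[R]_d * H) := ln (f z.1 z.2 theta).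
pose Good := [set z : 'rV[R]_d * H | Xi z.1].
have [g [ig Lg]] := f_dominated.
have [theta0 Tt0] : Theta !=set0.
  by have [c /nbhs_singleton Tc] := Theta_interior; exists c.
(* Theta is where the prior density is positive. *)
have mTheta : measurable Theta.
  rewrite (_ : Theta = p @^-1` `]0, +oo[).
    rewrite -[X in measurable X]setTI.
    by apply: (density_measurable (densityP p)) => //; exact: measurable_itv.
  apply/seteqP; split => theta /=; rewrite in_itv/= andbT.
    by move=> /p_bounds/andP[+ _]; exact: lt_le_trans.
  move=> p0; apply: contrapT => nT; move: p0.
  by rewrite (density_off (densityP p) nT) ltxx.
have mL theta : Theta theta -> measurable_fun setT (L theta).
  move=> Tt; apply: (measurable_fun_finite_snd (fun x h => ln (f x h theta))) => h.
  by apply: measurableT_comp => //; exact: density_measurable (f_density h theta Tt).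
have cL z : Good z -> {within Theta, continuous (L ^~ z)}.
  move=> Gz; apply/subspace_continuousP => theta Tt.
  have /subspace_continuousP/(_ theta Tt) cf := f_continuous z.1 z.2 Gz.
  by apply: (cvg_comp _ _ cf); apply: continuous_ln; exact: f_gt0.
(* Off Xi the density q vanishes, and the stationary law does not charge the
   zeros of q. *)
have aeGood : {ae pi, forall z, Good z}.
  pose N := [set z : 'rV[R]_d * H | q z.2 z.1 = 0].
  have mq : measurable_fun setT (fun z : 'rV[R]_d * H => q z.2 z.1).
    apply: (measurable_fun_finite_snd (fun x h => q h x)) => h.
    exact: density_measurable (densityP (q h)).
  exists N; split.
  - rewrite (_ : N = (fun z : 'rV[R]_d * H => q z.2 z.1) @^-1` [set 0])//.
    by rewrite -[X in measurable X]setTI; exact: mq.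
  - rewrite /pi/= /stationary_law; apply: integral0_eq => z.
    by rewrite /N/= => ->.
  - by move=> z /= nG; apply: (density_off (densityP (q z.2))).
have [t tT t_dense] := dense_sequence Theta theta0 Tt0.
pose lam := mean_value pi L.
have iL theta : Theta theta -> pi.-integrable setT (EFin \o L theta).
  exact: (family_integrable pi Theta L g mL ig Lg).
have lamE theta : Theta theta -> expected_loglik nu q f theta = (lam theta)%:E.
  move=> Tt; rewrite /expected_loglik unlock /lam /mean_value /Rintegral fineK//.
  exact: (integrable_fin_num measurableT (iL theta Tt)).
have clam : {within Theta, continuous lam}.
  exact: (mean_value_continuous pi Theta L g Good Theta_compact mL cL aeGood
    ig Lg t tT t_dense).
have lln phi : measurable_fun setT phi -> pi.-integrable setT (EFin \o phi) ->
    {ae P, forall om, mean (fun i => phi (xi i om, eta i om)) @ \oo --> \int[pi]_z phi z}.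
  exact: (data_strong_law w q xi eta data nu nu_stationary w_irreducible phi).
have ae_unif : {ae P, forall om, forall e, 0 < e ->
    \forall N \near \oo, forall theta, Theta theta ->
    `|mean (fun i => L theta (xi i om, eta i om)) N - lam theta| <= e}.
  have a1 : {ae P, forall om, forall i,
      mean (fun j => L (t i) (xi j om, eta j om)) @ \oo --> lam (t i)}.
    by apply/ae_foralln => i; apply: lln; [exact: mL|exact: iL].
  have a2 : {ae P, forall om, forall n,
      mean (fun j => oscillation L t n (xi j om, eta j om)) @ \oo -->
      \int[pi]_z oscillation L t n z}.
    apply/ae_foralln => n; apply: lln.
      exact: (measurable_oscillation Theta L mL t tT).
    exact: (oscillation_integrable pi Theta L g mL ig Lg t tT).
  move: a1 a2; apply: filterS2 => om a1 a2 e e0.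
  apply: (uniform_strong_law pi Theta L g Good Theta_compact mL cL aeGood ig Lg t tT t_dense
    (fun i => (xi i om, eta i om))) => // i.
  exact: (data_support data).
have [c0 /set_mem Tc0 c0P] := compact_EVT_max (ex_intro _ theta0 Tt0) Theta_compact clam.
have lam_le theta : Theta theta -> lam theta <= lam c0.
  by move=> Tt; apply: c0P; exact: mem_set.
set post := fun om => _; set Tstar := Theta_star _ _ _ _.
have Tstar_max theta : Theta theta -> lam theta = lam c0 -> Tstar theta.
  move=> Tt E; split => // y Ty; rewrite !lamE// lee_fin E; exact: lam_le.
have main : {ae P, forall om, forall eps : R, 0 < eps ->
    post om N [set theta | Theta theta /\ (eps%:E < dist theta Tstar)%E]
      @[N --> \oo] --> 0%E}.
  move: ae_unif; apply: filterS => om unif eps eps0.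
  have [delta delta0 deltaP] := max_gap Theta Tstar lam (lam c0) eps
    Theta_compact clam eps0 lam_le Tstar_max.
  have d40 : 0 < delta / 4 by rewrite divr_gt0.
  have [r r0 rP] := within_continuous_ball _ _ _ _ clam Tc0 d40.
  have [c [rho [rho0 VT Vr]]] :=
    convex_interior_ball Theta c0 r Theta_convex Theta_interior Tc0 r0.
  apply: (posterior_cvg0 Theta f p w (xi ^~ om) (eta ^~ om) c2 delta (lam c0) lam c rho) => //.
  - by move=> h k; have [w0 _] := data_stochastic data; exact: w0.
  - by move=> i theta Tt; apply: f_gt0 => //; exact: (data_support data).
  - move=> i; apply: within_continuous_measurable => //.
    by apply: (cL (xi i om, eta i om)); exact: (data_support data).
  - by move=> theta /p_bounds/andP[].
  - move=> theta Vt; have := rP _ (VT _ Vt) (Vr _ Vt).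
    by rewrite ltr_norml => /andP[_]; lra.
  - by apply: measurableI => //; exact: measurable_dist_gt.
  - by move=> theta [].
  - by move=> theta [Tt /dist_away]; exact: deltaP.
  - exact: unif.
split => // theta_star Ts; move: main; rewrite Ts.
apply: filterS => om H0 eps eps0; have := H0 eps eps0.
rewrite (_ : [set theta | _] =
  [set theta | Theta theta /\ eps < enorm (theta - theta_star)])//.
by apply/seteqP; split => theta /=; rewrite dist_set1 lte_fin.
Qed.
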